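(* Let $d\in\mathbb{N}$, let $\Gamma$ be an abelian group and suppose $\pi:\mathbb{Z}^d\to\Gamma$ is a surjective group homomorphism. For every $k\in\mathbb{N}$, if tiling by $k$ tiles in $\mathbb{Z}^d$ is algorithmically decidable, then tiling by $k$ tiles in $\Gamma$ is algorithmically decidable.
   Context: $\mathbb{N}$ denotes the positive integers. For an abelian group $\Gamma$ and subsets $A,B,C\subseteq\Gamma$, $A\oplus B=C$ means that $A+B=C$ and every $c\in C$ has a unique representation $c=a+b$ with $a\in A$, $b\in B$. $\biguplus$ denotes the union of pairwise disjoint sets. For finite subsets $F_1,\ldots,F_k\subset\Gamma$ and $E\subseteq\Gamma$, $$\mathit{Tile}(F_1,\ldots,F_k;E)=\Big\{(A_1,\ldots,A_k)\in(2^\Gamma)^k:\ \biguplus_{j=1}^k(F_j\oplus A_j)=E\Big\},$$ where $2^\Gamma$ is the set of all subsets of $\Gamma$. For a finitely generated abelian group $G$, tiling by $k$ tiles in $G$ is algorithmically decidable if there exists a Turing machine which takes as input a $k$-tuple $(F_1,\ldots,F_k)$ of finite subsets of $G$, always halts in finite time, and accepts the input if and only if $\mathit{Tile}(F_1,\ldots,F_k;G)\neq\emptyset$. Here finite subsets of $\mathbb{Z}^d$ are encoded as finite lists of integer vectors, and elements of the quotient $\Gamma$ of $\mathbb{Z}^d$ are encoded by representatives in $\mathbb{Z}^d$ under $\pi$ (or in any other standard computable encoding of the finitely generated abelian group $\Gamma$). *)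

(* Defs.v *)
From mathcomp Require Import all_boot all_order all_algebra.
From mathcomp Require Import classical_sets.

Set Implicit Arguments.
Unset Strict Implicit.
Unset Printing Implicit Defensive.

Import GRing.Theory.
Local Open Scope classical_set_scope.
Local Open Scope ring_scope.

Definition sumset (G : zmodType) (A B : set G) : set G :=
  [set a + b | a in A & b in B].

(** [is_oplus A B C] means A (+) B = C; it is a relation
    rather than an operation because the direct sum is only partially defined. *)
Definition is_oplus (G : zmodType) (A B C : set G) : Prop :=
  sumset A B = C /\
  forall c, C c -> exists! ab : G * G, [/\ A ab.1, B ab.2 & c = ab.1 + ab.2].

Definition Tile (G : zmodType) (k : nat) (F : 'I_k -> set G) (E : set G) :
    set ('I_k -> set G) :=
  [set A | exists S : 'I_k -> set G,
    [/\ forall j, is_oplus (F j) (A j) (S j),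
        trivIset setT S
      & \bigcup_j S j = E]].

(** The letters of input words: the unary digit, the minus sign, and the
    terminators of a coordinate, of a vector and of a finite set of vectors. *)
Inductive letter := Tick | Minus | EndInt | EndVec | EndSet.

Inductive direction := MoveLeft | Stay | MoveRight.

(** Deterministic machines with [tm_extra.+1] two-way infinite tapes; tape
    [ord0] carries the input and the other tapes start blank. *)
Record turing_machine := TuringMachine {
  tm_state : finType;
  tm_symbol : finType;
  tm_extra : nat;
  tm_blank : tm_symbol;
  tm_input : letter -> tm_symbol;
  tm_input_inj : injective tm_input;
  tm_input_blank : forall a, tm_input a != tm_blank;
  tm_start : tm_state;
  tm_accept : tm_state;
  tm_reject : tm_state;
  tm_accept_reject : tm_accept != tm_reject;
  tm_trans : tm_state -> {ffun 'I_tm_extra.+1 -> tm_symbol} ->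
    tm_state * {ffun 'I_tm_extra.+1 -> tm_symbol * direction}
}.

(** The cell under the head, the cells to its left (nearest first) and the cells
    to its right (nearest first); all cells beyond the two lists are blank. *)
Record tape (S : Type) := Tape {
  tape_left : seq S;
  tape_head : S;
  tape_right : seq S
}.

Definition tape_act (S : Type) (blank : S) (t : tape S) (a : S * direction) :
    tape S :=
  let: Tape l _ r := t in
  let: (c, m) := a in
  match m with
  | MoveLeft => Tape (behead l) (head blank l) (c :: r)
  | Stay => Tape l c r
  | MoveRight => Tape (c :: l) (head blank r) (behead r)
  end.

Section Run.
Variable M : turing_machine.

Record config := Config {
  config_state : tm_state M;
  config_tapes : {ffun 'I_(tm_extra M).+1 -> tape (tm_symbol M)}
}.

Definition halting (q : tm_state M) : bool :=
  (q == tm_accept M) || (q == tm_reject M).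

Definition step (c : config) : config :=
  if halting (config_state c) then c else
  let: (q, acts) := tm_trans (config_state c)
    [ffun i => tape_head (config_tapes c i)] in
  Config q [ffun i => tape_act (tm_blank M) (config_tapes c i) (acts i)].

Definition word_tape (w : seq (tm_symbol M)) : tape (tm_symbol M) :=
  Tape [::] (head (tm_blank M) w) (behead w).

Definition init_config (w : seq letter) : config :=
  Config (tm_start M)
    [ffun i => word_tape (if i == ord0 then map (@tm_input M) w else [::])].

Definition state_after (w : seq letter) (t : nat) : tm_state M :=
  config_state (iter t step (init_config w)).

Definition halts (w : seq letter) : Prop :=
  exists t, halting (state_after w t).

Definition accepts (w : seq letter) : Prop :=
  exists t, state_after w t = tm_accept M.

End Run.

Definition enc_int (z : int) : seq letter :=
  match z with
  | Posz n => nseq n Tick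
  | Negz n => Minus :: nseq n.+1 Tick (* [Negz n] is -(n+1) *)
  end ++ [:: EndInt].

Definition enc_vec (d : nat) (v : 'rV[int]_d) : seq letter :=
  flatten [seq enc_int (v ord0 i) | i <- enum 'I_d] ++ [:: EndVec].

Definition enc_list (d : nat) (s : seq 'rV[int]_d) : seq letter :=
  flatten [seq enc_vec v | v <- s] ++ [:: EndSet].

Definition enc_lists (d k : nat) (Fs : k.-tuple (seq 'rV[int]_d)) :
    seq letter :=
  flatten [seq enc_list s | s <- Fs].

(** The finite subset of G encoded by a list of representatives under [rho];
    neither the list nor its image under [rho] has to be duplicate-free. *)
Definition subset_of (d : nat) (G : zmodType) (rho : 'rV[int]_d -> G)
    (s : seq 'rV[int]_d) : set G :=
  [set rho v | v in [set` s]].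

(** Tiling by [k] tiles in G is algorithmically decidable, where [rho] is a
    surjection through which elements of G are encoded ([rho := id] for Z^d). *)
Definition tiling_decidable (d : nat) (G : zmodType) (rho : 'rV[int]_d -> G)
    (k : nat) : Prop :=
  exists M : turing_machine, forall Fs : k.-tuple (seq 'rV[int]_d),
    halts M (enc_lists Fs) /\
    (accepts M (enc_lists Fs) <->
     Tile (fun j => subset_of rho (tnth Fs j)) setT !=set0).

(* Main.v *)
Require Import Defs.
From mathcomp Require Import all_boot all_order all_algebra.
From mathcomp Require Import boolp classical_sets.
From mathcomp Require Import zify ring.

Set Implicit Arguments.
Unset Strict Implicit.
Unset Printing Implicit Defensive.

Import Order.TTheory GRing.Theory Num.Theory.

(** A computable map translates a tiling problem in the quotient into a tiling
    problem in Z^d with the same number of tiles, and the machine that decides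
    the latter is run on the translation.

    The translation enlarges the group one generator at a time. Let H be a
    subgroup of Z^d and K = H + Z u, where u has infinite order modulo H. Take a
    tiling problem modulo K in which every tile is given by one representative f
    for each of its elements. In the tile number j, replace f by the points
    f + b u, where b runs through a jigsaw piece: the integers from 0 to m - 1,
    with one of them, the dent, moved by m. The position of the dent is a number
    that encodes j and f. A piece is a complete system of residues modulo m;
    adding the multiples of m u to the translates of a tiling modulo K therefore
    gives a tiling modulo H ([jigsaw_lift]). Conversely, a tiling modulo H cuts
    every line x + Z u into jigsaw pieces. A dent can only be filled by the bump
    of a piece of the same kind, so all pieces on a line are of one kind
    ([single_piece]), which says that x has one representation modulo K
    ([jigsaw_descend]).

    Such steps lead from the trivial subgroup to the kernel of the projection:
    the vectors of the kernel that vanish on the first l coordinates form a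
    chain of subgroups in which consecutive ones are equal or differ by one
    generator, whose coordinate number l is not zero ([truncate_step]). Input
    lists may contain several representatives of one element, and these have to
    receive the same piece; so each step first replaces vectors by canonical
    representatives, which are found by reducing one coordinate after the other
    ([reducible_extend]).

    The other half is to run this translation on a Turing machine. Programs are
    control graphs, composed in sequence, by branching and by loops, that treat
    tapes as stacks of letters. Binary trees in prefix notation can be stacked,
    and the functions on trees that such programs compute are closed under
    composition, pairing, case distinction and iteration along a list. Numbers,
    lists, vectors and words are encoded by trees, so computability of the
    translation follows from the way it is written as a functional program
    ([jigsaw_comp], [parse_lists_comp], [print_lists_comp]), and
    [computable_reduction] places it in front of the given machine. *)

(** * Structured programs on tapes *)

Section Flows.
Variables (I S : finType) (blank : S).
Implicit Types (T : {ffun I -> tape S}) (i : I).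

Definition scan T : {ffun I -> S} := [ffun i => tape_head (T i)].

Definition act_all T (acts : {ffun I -> S * direction}) :=
  [ffun i => tape_act blank (T i) (acts i)].

Definition set_tape T i (t : tape S) := [ffun j => if j == i then t else T j].

(** A control graph with one entry and one exit; moving to [None] is leaving
    the graph. *)
Record flow := Flow {
  node : finType;
  entry : node;
  next : node -> {ffun I -> S} -> option node * {ffun I -> S * direction}
}.

Inductive exits_from (F : flow) : node F -> {ffun I -> tape S} ->
    {ffun I -> tape S} -> Prop :=
| Exit q T acts :
    next q (scan T) = (None, acts) -> exits_from q T (act_all T acts)
| Continue q q' T T' acts :
    next q (scan T) = (Some q', acts) ->
    exits_from q' (act_all T acts) T' -> exits_from q T T'.

Definition runs (F : flow) T T' := exits_from (entry F) T T'.

Definition idle (s : {ffun I -> S}) : {ffun I -> S * direction} :=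
  [ffun j => (s j, Stay)].

Lemma act_idle T : act_all T (idle (scan T)) = T.
Proof. by apply/ffunP=> j; rewrite !ffunE; case: (T j). Qed.

Definition skip : flow := @Flow unit tt (fun _ s => (None, idle s)).

Lemma runs_skip T : runs skip T T.
Proof. by rewrite -{2}(act_idle T); exact: Exit. Qed.

Definition act i (a : S * direction) : flow :=
  @Flow unit tt (fun _ s => (None, [ffun j => if j == i then a else idle s j])).

Lemma runs_act i a T : runs (act i a) T (set_tape T i (tape_act blank (T i) a)).
Proof.
set T' := set_tape _ _ _; rewrite (_ : T' = act_all T
    [ffun j => if j == i then a else idle (scan T) j]); first exact: Exit.
apply/ffunP=> j; rewrite !ffunE; case: eqP => [-> //|_].
by case: (T j).
Qed.

Definition chain (F G : flow) : flow :=
  @Flow (node F + node G)%type (inl (entry F)) (fun q s =>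
    match q with
    | inl q => let: (o, acts) := next q s in
        (Some (if o is Some q' then inl q' else inr (entry G)), acts)
    | inr q => let: (o, acts) := next q s in (omap inr o, acts)
    end).

Lemma exits_chainr F G q T T' :
  @exits_from G q T T' -> @exits_from (chain F G) (inr q) T T'.
Proof.
elim=> [{}q T1 acts E | {}q q' T1 T2 acts E _ IH].
  by apply: Exit; rewrite /= E.
by apply: (Continue _ IH); rewrite /= E.
Qed.

Lemma runs_chain F G T T1 T' :
  runs F T T1 -> runs G T1 T' -> runs (chain F G) T T'.
Proof.
rewrite /runs /=; elim=> [q T2 acts E rG | q q' T2 T3 acts E _ IH rG].
  apply: (@Continue (chain F G) (inl q) (inr (entry G)) _ _ acts).
    by rewrite /= E.
  exact: exits_chainr.
by apply: (Continue _ (IH rG)); rewrite /= E.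
Qed.

Definition branch i (P : S -> flow) : flow :=
  @Flow (option {x : S & node (P x)}) None (fun q s =>
    match q with
    | None => (Some (Some (Tagged (fun x => node (P x)) (entry (P (s i))))),
               idle s)
    | Some (existT x q) => let: (o, acts) := next q s in
        (omap (fun q' => Some (Tagged (fun x => node (P x)) q')) o, acts)
    end).

Lemma exits_branch i P x (q : node (P x)) T T' :
  exits_from q T T' ->
  @exits_from (branch i P) (Some (Tagged (fun x => node (P x)) q)) T T'.
Proof.
elim=> [{}q T1 acts E | {}q q' T1 T2 acts E _ IH].
  by apply: Exit; rewrite /= E.
by apply: (Continue _ IH); rewrite /= E.
Qed.

Lemma runs_branch i P T T' :
  runs (P (tape_head (T i))) T T' -> runs (branch i P) T T'.
Proof.
move=> /exits_branch-/(_ i) rP.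
apply: (@Continue (branch i P) None _ _ _ (idle (scan T)) erefl).
by rewrite act_idle ffunE.
Qed.

Definition while i (b : pred S) (F : flow) : flow :=
  @Flow (option (node F)) None (fun q s =>
    match q with
    | None => (if b (s i) then Some (Some (entry F)) else None, idle s)
    | Some q => let: (o, acts) := next q s in (Some o, acts)
    end).

Lemma runs_while_stop i (b : pred S) F T :
  ~~ b (tape_head (T i)) -> runs (while i b F) T T.
Proof.
move=> /negbTE nb; rewrite -{2}(act_idle T).
by apply: Exit; rewrite /= ffunE nb.
Qed.

Lemma runs_while_step i (b : pred S) F T T1 T' :
  b (tape_head (T i)) -> runs F T T1 -> runs (while i b F) T1 T' ->
  runs (while i b F) T T'.
Proof.
move=> bT rF rW; apply: (@Continue (while i b F) None (Some (entry F)) _ _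
  (idle (scan T))); first by rewrite /= ffunE bT.
rewrite act_idle; elim: rF rW => [q T2 acts E | q q' T2 T3 acts E _ IH] rW.
  by apply: (Continue _ rW); rewrite /= E.
by apply: (Continue _ (IH rW)); rewrite /= E.
Qed.

End Flows.

(** * A machine that runs a program and then another machine *)

Section Prefix.
Variables (M : turing_machine) (n : nat).
Let e := tm_extra M.
Let I : finType := 'I_(n.+1 + e.+1).
Variable F : flow I (tm_symbol M).

Definition prefix_trans (q : node F + tm_state M)
    (s : {ffun 'I_(n + e.+1).+1 -> tm_symbol M}) :
    (node F + tm_state M) *
    {ffun 'I_(n + e.+1).+1 -> tm_symbol M * direction} :=
  match q with
  | inl q => let: (o, acts) := next q (s : {ffun I -> tm_symbol M}) in
      (if o is Some q' then inl q' else inr (tm_start M), acts)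
  | inr q =>
      let: (q', acts) := tm_trans q [ffun j => s (rshift n.+1 j)] in
      (inr q', [ffun j : I => match split j with
                              | inl _ => (s j, Stay)
                              | inr j' => acts j'
                              end])
  end.

Fact prefix_accept_reject :
  inr (tm_accept M) != inr (tm_reject M) :> node F + tm_state M.
Proof. by rewrite (inj_eq inr_inj) tm_accept_reject. Qed.

Definition prefix_machine : turing_machine :=
  @TuringMachine (node F + tm_state M)%type (tm_symbol M) (n + e.+1)
    (tm_blank M) (@tm_input M) (@tm_input_inj M) (@tm_input_blank M)
    (inl (entry F)) (inr (tm_accept M)) (inr (tm_reject M))
    prefix_accept_reject prefix_trans.

Definition own_tapes (c : config prefix_machine) :
    {ffun 'I_e.+1 -> tape (tm_symbol M)} :=
  [ffun j => config_tapes c (rshift n.+1 j : I)].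

(** Once the program has ended, the combined machine moves the last tapes as [M]
    does and rewrites every cell under the other heads with its own content. *)
Lemma prefix_sim t (c : config prefix_machine) (c' : config M) :
  config_state c = inr (config_state c') -> own_tapes c = config_tapes c' ->
  config_state (iter t (@step _) c) = inr (config_state (iter t (@step _) c')).
Proof.
elim: t c c' => [//|t IH] c c' Es Et; rewrite !iterSr.
have Eh : halting (config_state c) = halting (config_state c').
  by rewrite Es /halting /= !(inj_eq inr_inj).
apply: IH; rewrite /step Eh; case: ifP => // _.
  rewrite Es /= /prefix_trans.
  rewrite (_ : [ffun j => _] = [ffun i => tape_head (config_tapes c' i)]).
    by case: (tm_trans _ _).
  by apply/ffunP=> j; rewrite !ffunE -Et !ffunE.
rewrite Es /= /prefix_trans.
rewrite (_ : [ffun j => _] = [ffun i => tape_head (config_tapes c' i)]).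
  case: (tm_trans _ _) => q acts /=; apply/ffunP=> j.
  rewrite !ffunE /=. rewrite (_ : split _ = inr j) -?Et ?ffunE //.
  by rewrite -[rshift _ _]/(unsplit (inr j)) unsplitK.
by apply/ffunP=> j; rewrite !ffunE -Et !ffunE.
Qed.

Lemma prefix_flow (q : node F) T T' :
  exits_from (tm_blank M) q T T' ->
  exists t, iter t (@step prefix_machine) (@Config prefix_machine (inl q) T)
    = @Config prefix_machine (inr (tm_start M)) T'.
Proof.
elim=> [{}q T1 acts E | {}q q' T1 T2 acts E _ [t IH]].
  by exists 1%N; rewrite /= /step /= E.
by exists t.+1; rewrite iterSr /step /= E.
Qed.

Lemma halting_iter (N : turing_machine) t (c : config N) :
  halting (config_state c) -> iter t (@step N) c = c.
Proof. by move=> hc; elim: t => [//|t IH]; rewrite iterS IH /step hc. Qed.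

(** Acceptance is compared at a time when the program has ended; this loses
    nothing, because a machine that has halted stays in its state. *)
Lemma prefix_correct w w' T' :
  runs (tm_blank M) F (config_tapes (init_config prefix_machine w)) T' ->
  [ffun j => T' (rshift n.+1 j : I)] = config_tapes (init_config M w') ->
  (halts M w' -> halts prefix_machine w) /\
  (accepts prefix_machine w <-> accepts M w').
Proof.
case/prefix_flow=> t0 E ET.
have sim t : state_after prefix_machine w (t + t0) = inr (state_after M w' t).
  rewrite /state_after iterD [iter t0 _ _]E.
  by apply: prefix_sim => //; rewrite -ET.
split.
  by case=> t ht; exists (t + t0)%N; rewrite sim /halting /= !(inj_eq inr_inj).
split=> [[t ht]|[t ht]]; last by exists (t + t0)%N; rewrite sim ht.
exists t; have := sim t; rewrite addnC /state_after iterD halting_iter; last first.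
  by rewrite /halting -/(state_after _ _ _) ht eqxx.
by rewrite -/(state_after _ _ _) ht => -[<-].
Qed.

End Prefix.
(** * Trees and their encodings *)

Inductive tree := Leaf | Node of tree & tree.

(** Prefix notation is self-delimiting, so that trees can be stacked. *)
Fixpoint code (t : tree) : seq letter :=
  match t with
  | Leaf => [:: EndInt]
  | Node x y => Tick :: code x ++ code y
  end.

Class encodable (A : Type) := encode : A -> tree.

Fixpoint encode_nat n := if n is n'.+1 then Node Leaf (encode_nat n') else Leaf.

Fixpoint encode_seq A (encA : encodable A) (s : seq A) :=
  if s is a :: s' then Node (encode a) (encode_seq encA s') else Leaf.

#[export] Instance nat_encodable : encodable nat := encode_nat.
#[export] Instance seq_encodable A (encA : encodable A) : encodable (seq A) :=
  encode_seq encA.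
#[export] Instance prod_encodable A B (encA : encodable A) (encB : encodable B) :
  encodable (A * B) := fun p => Node (encode p.1) (encode p.2).
#[export] Instance bool_encodable : encodable bool :=
  fun b => if b then Leaf else Node Leaf Leaf.
#[export] Instance int_encodable : encodable int := fun z =>
  match z with
  | Posz n => Node Leaf (encode n)
  | Negz n => Node (Node Leaf Leaf) (encode n)
  end.
#[export] Instance letter_encodable : encodable letter := fun a =>
  encode (match a with
          | Tick => 0 | Minus => 1 | EndInt => 2 | EndVec => 3 | EndSet => 4
          end)%N.

(** * Stacks of letters *)

Section Stacks.
Variable M : turing_machine.
Local Notation S := (tm_symbol M).
Local Notation blank := (tm_blank M).
Local Notation inp := (@tm_input M).
Let e := tm_extra M.
Let I : finType := 'I_(4 + e.+1).
Implicit Types (T : {ffun I -> tape S}) (w : seq letter).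

(** [StackA] is the input tape of the combined machine and [Output] the input
    tape of [M]. *)
Inductive reg := Main | StackA | StackB | Counter | Output.

Definition tape_of (r : reg) : I :=
  match r with
  | StackA => lshift e.+1 (inord 0 : 'I_4)
  | Main => lshift e.+1 (inord 1 : 'I_4)
  | StackB => lshift e.+1 (inord 2 : 'I_4)
  | Counter => lshift e.+1 (inord 3 : 'I_4)
  | Output => rshift 4 (ord0 : 'I_e.+1)
  end.

Definition upd (st : reg -> seq letter) r w : reg -> seq letter := fun r' =>
  match r, r' with
  | Main, Main | StackA, StackA | StackB, StackB
  | Counter, Counter | Output, Output => w
  | _, _ => st r'
  end.

Arguments upd st !r w !r' /.

Lemma upd_same st r w : upd st r w r = w.
Proof. by case: r. Qed.

Lemma upd_other st r w r' : r <> r' -> upd st r w r' = st r'.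
Proof. by case: r; case: r'. Qed.

Lemma tape_of_inj : injective tape_of.
Proof.
by case=> -[] //= /(congr1 val) /=; rewrite ?inordK // ?add0n => /eqP.
Qed.

Definition letter_of (s : S) : option letter :=
  if s == inp Tick then Some Tick else
  if s == inp Minus then Some Minus else
  if s == inp EndInt then Some EndInt else
  if s == inp EndVec then Some EndVec else
  if s == inp EndSet then Some EndSet else None.

Lemma letter_of_input a : letter_of (inp a) = Some a.
Proof.
have F x y : inp x == inp y -> x = y by move/eqP/(@tm_input_inj M).
by case: a; rewrite /letter_of; do ?[case: ifP => [/F //|]]; rewrite eqxx.
Qed.

Lemma letter_of_blank : letter_of blank = None.
Proof.
by rewrite /letter_of !(eq_sym blank) !(negbTE (@tm_input_blank M _)).
Qed.

Lemma letter_of_head w : letter_of (head blank (map inp w)) = ohead w.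
Proof. by case: w => [|a w] /=; rewrite (letter_of_blank, letter_of_input). Qed.

(** The head is on the top. Popping leaves blanks on the left; the tape of [M] is
    never popped, so it has [p = 0] and is a word as [M] expects it. *)
Definition stack_tape p w : tape S :=
  Tape (nseq p blank) (head blank (map inp w)) (behead (map inp w)).

Definition holds T (st : reg -> seq letter) : Prop :=
  (forall r, exists2 p, T (tape_of r) = stack_tape p (st r) &
     r = Output -> p = 0%N) /\
  (forall j : 'I_e.+1, j != ord0 -> T (rshift 4 j) = @word_tape M [::]).

(** Only the letters on the stacks matter here, not the number of blanks that
    popping has left behind. *)
Record effect (F : flow I S) (st st' : reg -> seq letter) : Prop := Effect {
  effectP : forall T, holds T st -> exists2 T', runs blank F T T' & holds T' st'
}.

Lemma effect_skip st : effect (skip I S) st st.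
Proof. by split=> T hT; exists T => //; exact: runs_skip. Qed.

Lemma effect_chain F G st st1 st' :
  effect F st st1 -> effect G st1 st' -> effect (chain F G) st st'.
Proof.
move=> [eF] [eG]; split=> T /eF[T1 r1 /eG[T2 r2 h2]].
by exists T2 => //; exact: runs_chain r1 r2.
Qed.

Lemma holds_upd T st r w p :
  holds T st -> (r = Output -> p = 0%N) ->
  holds (set_tape T (tape_of r) (stack_tape p w)) (upd st r w).
Proof.
move=> [hT hM] hp; split=> [r'|j j0]; last first.
  rewrite ffunE ifN ?hM //; case: r hp => _; rewrite -val_eqE /= ?inordK //;
    by rewrite ?neq_ltn ?ltn_addr ?orbT // eqn_add2l -lt0n lt0n.
rewrite ffunE; case: eqP => [/tape_of_inj->|neq].
  by exists p => //; rewrite upd_same.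
have [q -> hq] := hT r'; exists q => //; rewrite upd_other // => E.
by apply: neq; rewrite E.
Qed.

Lemma holds_top T st r : holds T st ->
  tape_head (T (tape_of r)) = head blank (map inp (st r)).
Proof. by case=> /(_ r)[p -> _]. Qed.

Definition top r (P : option letter -> flow I S) : flow I S :=
  branch (tape_of r) (fun s => P (letter_of s)).

Lemma effect_top r P st st' :
  effect (P (ohead (st r))) st st' -> effect (top r P) st st'.
Proof.
move=> [eP]; split=> T hT; have [T' rT hT'] := eP T hT; exists T' => //.
by apply: runs_branch; rewrite (holds_top _ hT) letter_of_head.
Qed.

Definition push r a : flow I S :=
  branch (tape_of r) (fun s =>
    (* A blank under the head means that the stack is empty. *)
    if s == blank then act (tape_of r) (inp a, Stay)
    else chain (act (tape_of r) (s, MoveLeft)) (act (tape_of r) (inp a, Stay))).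

Lemma effect_push r a st : effect (push r a) st (upd st r (a :: st r)).
Proof.
split=> T hT; have [/(_ r)[p Tr hp] _] := hT.
have [q E hq] : exists2 q, stack_tape q (a :: st r) =
    (if st r is _ :: _ then stack_tape p.-1 (a :: st r)
     else stack_tape p (a :: st r)) & (r = Output -> q = 0%N).
  by case: (st r) => [|b w]; [exists p | exists p.-1 => // /hp->].
exists (set_tape T (tape_of r) (stack_tape q (a :: st r))); last exact: holds_upd.
apply: runs_branch; rewrite Tr E; case: (st r) Tr => [|b w] /= Tr.
  rewrite eqxx (_ : stack_tape _ _ = tape_act blank (T (tape_of r)) (inp a, Stay)).
    exact: runs_act.
  by rewrite Tr.
rewrite (negbTE (@tm_input_blank M _)); apply: runs_chain (runs_act _ _ _ _) _.
set T1 := set_tape _ _ _.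
rewrite (_ : set_tape _ _ _ =
  set_tape T1 (tape_of r) (tape_act blank (T1 (tape_of r)) (inp a, Stay))).
  exact: runs_act.
apply/ffunP=> j; rewrite !ffunE eqxx; case: eqP => // _.
by rewrite Tr /=; case: p {Tr hp E}.
Qed.

Definition pop r : flow I S := act (tape_of r) (blank, MoveRight).

Lemma effect_pop r st : r <> Output -> effect (pop r) st (upd st r (behead (st r))).
Proof.
move=> rO; split=> T hT; have [/(_ r)[p Tr _] _] := hT.
exists (set_tape T (tape_of r) (stack_tape p.+1 (behead (st r)))); last first.
  exact: holds_upd.
rewrite (_ : stack_tape _ _ = tape_act blank (T (tape_of r)) (blank, MoveRight)).
  exact: runs_act.
by rewrite Tr /=; case: (st r) => [|b [|c w]].
Qed.

(** [P] may push on the same stack; the loop ends when the stack is empty. *)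
Definition each r (P : letter -> flow I S) : flow I S :=
  while (tape_of r) (fun s => s != blank)
    (top r (fun o => if o is Some a then chain (pop r) (P a) else skip I S)).

Lemma effect_each_nil r P st : st r = [::] -> effect (each r P) st st.
Proof.
move=> E; split=> T hT; exists T => //; apply: runs_while_stop.
by rewrite (holds_top _ hT) E negbK.
Qed.

Lemma effect_each_cons r P st a w st1 st' :
  r <> Output -> st r = a :: w -> effect (P a) (upd st r w) st1 ->
  effect (each r P) st1 st' -> effect (each r P) st st'.
Proof.
move=> rO E eP [eW].
have [|eT] := @effect_top r (fun o => if o is Some a then chain (pop r) (P a)
    else skip I S) st st1.
  rewrite E /=; apply: effect_chain eP.
  by rewrite -[w]/(behead (a :: w)) -E; exact: effect_pop.
split=> T hT; have [T1 r1 /eW[T2 r2 h2]] := eT T hT.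
exists T2 => //; apply: runs_while_step r1 r2.
by rewrite (holds_top _ hT) E /= tm_input_blank.
Qed.

Definition while_top r a (P : flow I S) : flow I S :=
  while (tape_of r) (fun s => s == inp a) P.

Lemma effect_while_stop r a P st :
  ohead (st r) <> Some a -> effect (while_top r a P) st st.
Proof.
move=> E; split=> T hT; exists T => //; apply: runs_while_stop.
rewrite (holds_top _ hT); apply/negP=> /eqP Ea; apply: E.
by rewrite -letter_of_head Ea letter_of_input.
Qed.

Lemma effect_while_step r a w P st st1 st' :
  st r = a :: w -> effect P st st1 -> effect (while_top r a P) st1 st' ->
  effect (while_top r a P) st st'.
Proof.
move=> E [eP] [eW]; split=> T hT; have [T1 r1 /eW[T2 r2 h2]] := eP T hT.
by exists T2 => //; apply: runs_while_step r1 r2; rewrite (holds_top _ hT) E /=.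
Qed.

(** * Tree functions computed on a stack *)

Lemma effect_eq (F : flow I S) st st1 st' :
  effect F st st1 -> st1 =1 st' -> effect F st st'.
Proof. by move=> eF /funext <-. Qed.

Lemma effect_from (F : flow I S) st st1 st' :
  st =1 st1 -> effect F st1 st' -> effect F st st'.
Proof. by move=> /funext->. Qed.

Definition pour r r' : flow I S := each r (fun a => push r' a).

Lemma effect_pour r r' st : r <> Output -> r <> r' ->
  effect (pour r r') st (upd (upd st r [::]) r' (catrev (st r) (st r'))).
Proof.
move=> rO rr'; move E: (st r) => w; elim: w st E => [|a w IH] st E.
  apply: effect_eq; first exact: effect_each_nil.
  by clear rO; case: r rr' E; case: r' => // _ E -[] //=.
apply: (effect_each_cons rO E); first exact: effect_push.
apply: effect_eq; first by apply: IH; rewrite upd_other ?upd_same // => /esym.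
by clear IH E rO; case: r rr'; case: r' => // _ -[].
Qed.

Definition clear r : flow I S := each r (fun _ => skip I S).

Lemma effect_clear r st : r <> Output -> effect (clear r) st (upd st r [::]).
Proof.
move=> rO; move E: (st r) => w; elim: w st E => [|a w IH] st E.
  apply: effect_eq; first exact: effect_each_nil.
  by clear rO; case: r E => E -[].
apply: (effect_each_cons rO E); first exact: effect_skip.
apply: effect_eq; first by apply: IH; rewrite upd_same.
by clear rO E IH; case: r => -[].
Qed.

(** Moves a tree off the main stack. The counter holds one letter for each
    subtree that remains to be read. *)
Definition take_step r (_ : letter) : flow I S :=
  top Main (fun o =>
    match o with
    | Some Tick => chain (chain (pop Main) (push r Tick))
                         (chain (push Counter Tick) (push Counter Tick))
    | Some a => chain (pop Main) (push r a)
    | None => skip I S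
    end).

Definition take_tree r : flow I S :=
  chain (push Counter Tick) (each Counter (take_step r)).

Lemma effect_take_loop r t st a c u st' : r = StackA \/ r = StackB ->
  st Main = code t ++ u -> st Counter = a :: c ->
  effect (each Counter (take_step r))
    (upd (upd (upd st Main u) r (catrev (code t) (st r))) Counter c) st' ->
  effect (each Counter (take_step r)) st st'.
Proof.
move=> hr; elim: t st a c u => [|x IHx y IHy] st a c u Em Ec.
  apply: (effect_each_cons _ Ec) => //; apply: effect_top; rewrite /= Em /=.
  apply: effect_chain; first exact: effect_pop.
  apply: effect_eq; first exact: effect_push.
  by case: hr => ->; case; rewrite //= Em.
move=> ef.
pose st1 := upd (upd (upd st Main (code x ++ code y ++ u)) r (Tick :: st r))
  Counter (Tick :: Tick :: c).
apply: (effect_each_cons (st1 := st1) _ Ec) => //.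
  apply: effect_top; rewrite /= Em /=.
  apply: effect_chain.
    apply: effect_chain; first exact: effect_pop.
    exact: effect_push.
  apply: effect_chain; first exact: effect_push.
  apply: effect_eq; first exact: effect_push.
  by rewrite /st1; case: hr => ->; case; rewrite //= Em /= ?catA.
have E1m : st1 Main = code x ++ code y ++ u by rewrite /st1; case: hr => ->.
apply: (IHx _ _ _ _ E1m erefl).
set st2 := upd _ _ _.
have E2m : st2 Main = code y ++ u by rewrite /st2; case: hr => ->.
apply: (IHy _ _ _ _ E2m erefl).
apply: effect_from ef; rewrite /st2 /st1.
by case: hr => ->; case; rewrite //= ?catrev_catl.
Qed.

Lemma effect_take r t st u : r = StackA \/ r = StackB ->
  st Main = code t ++ u -> st Counter = [::] ->
  effect (take_tree r) st (upd (upd st Main u) r (catrev (code t) (st r))).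
Proof.
move=> hr Em Ec; apply: effect_chain; first exact: effect_push.
apply: (effect_take_loop hr) => //=; first exact: Em.
apply: effect_eq; first exact: effect_each_nil.
by case: hr => ->; case; rewrite //= Ec.
Qed.

Definition stacks m a b : reg -> seq letter := fun r =>
  match r with Main => m | StackA => a | StackB => b | _ => [::] end.

Lemma effect_take_A t u a b :
  effect (take_tree StackA) (stacks (code t ++ u) a b)
    (stacks u (catrev (code t) a) b).
Proof. by apply: effect_eq; [apply: effect_take => //; left | case]. Qed.

Lemma effect_take_B t u a b :
  effect (take_tree StackB) (stacks (code t ++ u) a b)
    (stacks u a (catrev (code t) b)).
Proof. by apply: effect_eq; [apply: effect_take => //; right | case]. Qed.

Lemma effect_pour_A w m b :
  effect (pour StackA Main) (stacks m (catrev w [::]) b) (stacks (w ++ m) [::] b).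
Proof.
apply: effect_eq; first exact: effect_pour.
by case=> //=; rewrite -[catrev w _]/(rev w) catrevE revK.
Qed.

Lemma effect_pour_B w m a :
  effect (pour StackB Main) (stacks m a (catrev w [::])) (stacks (w ++ m) a [::]).
Proof.
apply: effect_eq; first exact: effect_pour.
by case=> //=; rewrite -[catrev w _]/(rev w) catrevE revK.
Qed.

Lemma effect_clear_A m a b :
  effect (clear StackA) (stacks m a b) (stacks m [::] b).
Proof. by apply: effect_eq; [exact: effect_clear | case]. Qed.

Lemma effect_clear_B m a b :
  effect (clear StackB) (stacks m a b) (stacks m a [::]).
Proof. by apply: effect_eq; [exact: effect_clear | case]. Qed.

Lemma effect_push_main l m a b :
  effect (push Main l) (stacks m a b) (stacks (l :: m) a b).
Proof. by apply: effect_eq; [exact: effect_push | case]. Qed.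

Lemma effect_pop_main l m a b :
  effect (pop Main) (stacks (l :: m) a b) (stacks m a b).
Proof. by apply: effect_eq; [exact: effect_pop | case]. Qed.

(** The program may not touch what lies under its argument; a function may
    therefore keep intermediate values there. *)
Definition tree_computable (f : tree -> tree) : Prop :=
  exists F : flow I S, forall t u,
    effect F (stacks (code t ++ u) [::] [::]) (stacks (code (f t) ++ u) [::] [::]).

Lemma tree_ext f g : f =1 g -> tree_computable f -> tree_computable g.
Proof. by move=> /funext->. Qed.

Lemma tree_id : tree_computable id.
Proof. by exists (skip I S) => t u; exact: effect_skip. Qed.

Lemma tree_comp f g :
  tree_computable f -> tree_computable g -> tree_computable (f \o g).
Proof.
by move=> [F eF] [G eG]; exists (chain G F) => t u; apply: effect_chain.
Qed.

Fixpoint push_word (w : seq letter) : flow I S :=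
  if w is a :: w then chain (push_word w) (push Main a) else skip I S.

Lemma effect_push_word w m a b :
  effect (push_word w) (stacks m a b) (stacks (w ++ m) a b).
Proof.
elim: w => [|l w IH] /=; first exact: effect_skip.
by apply: effect_chain; [exact: IH | exact: effect_push_main].
Qed.

Lemma tree_const c : tree_computable (fun=> c).
Proof.
exists (chain (take_tree StackA) (chain (clear StackA) (push_word (code c)))) => t u.
apply: effect_chain; first exact: effect_take_A.
apply: effect_chain; first exact: effect_clear_A.
exact: effect_push_word.
Qed.

Definition tree_left t := if t is Node x _ then x else Leaf.
Definition tree_right t := if t is Node _ y then y else Leaf.

Lemma tree_leftP : tree_computable tree_left.
Proof.
pose down := chain (chain (pop Main) (take_tree StackA))
  (chain (chain (take_tree StackB) (clear StackB)) (pour StackA Main)).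
exists (top Main (fun o => if o is Some Tick then down else skip I S)).
move=> [|x y] u; apply: effect_top => /=; first exact: effect_skip.
rewrite -catA; apply: effect_chain.
  apply: effect_chain; first exact: effect_pop_main.
  exact: effect_take_A.
apply: effect_chain.
  apply: effect_chain; first exact: effect_take_B.
  exact: effect_clear_B.
exact: effect_pour_A.
Qed.

Lemma tree_rightP : tree_computable tree_right.
Proof.
pose down := chain (chain (pop Main) (take_tree StackA)) (clear StackA).
exists (top Main (fun o => if o is Some Tick then down else skip I S)).
move=> [|x y] u; apply: effect_top => /=; first exact: effect_skip.
rewrite -catA; apply: effect_chain.
  apply: effect_chain; first exact: effect_pop_main.
  exact: effect_take_A.
exact: effect_clear_A.
Qed.

Definition dup : flow I S :=
  chain (chain (take_tree StackA) (each StackA (fun a =>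
           chain (push Main a) (push StackB a))))
        (chain (pour StackB StackA) (pour StackA Main)).

Lemma effect_dup t u : effect dup (stacks (code t ++ u) [::] [::])
  (stacks (code t ++ code t ++ u) [::] [::]).
Proof.
apply: (effect_chain (st1 := stacks (code t ++ u) [::] (code t))).
  apply: effect_chain; first exact: effect_take_A.
  have loop w m b : effect (each StackA (fun a => chain (push Main a) (push StackB a)))
      (stacks m w b) (stacks (catrev w m) [::] (catrev w b)).
    elim: w m b => [|l w IH] m b; first exact: effect_each_nil.
    apply: effect_each_cons => //; last exact: IH.
    apply: effect_chain; first exact: effect_push.
    by apply: effect_eq; [exact: effect_push | case].
  apply: effect_eq; first exact: loop.
  by case=> //=; rewrite -[catrev (code t) _]/(rev _) catrevE revK ?cats0.
apply: effect_chain; last exact: effect_pour_A.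
by apply: effect_eq; [exact: effect_pour | case].
Qed.

Definition swap : flow I S :=
  chain (chain (take_tree StackA) (take_tree StackB))
        (chain (pour StackA Main) (pour StackB Main)).

Lemma effect_swap x y u : effect swap (stacks (code x ++ code y ++ u) [::] [::])
  (stacks (code y ++ code x ++ u) [::] [::]).
Proof.
apply: effect_chain.
  by apply: effect_chain; [exact: effect_take_A | exact: effect_take_B].
by apply: effect_chain; [exact: effect_pour_A | exact: effect_pour_B].
Qed.

Lemma tree_node f g : tree_computable f -> tree_computable g ->
  tree_computable (fun t => Node (f t) (g t)).
Proof.
move=> [F eF] [G eG].
exists (chain (chain (chain dup F) (chain swap G)) (chain swap (push Main Tick))).
move=> t u; apply: effect_chain.
  apply: effect_chain.
    by apply: effect_chain; [exact: effect_dup | exact: eF].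
  by apply: effect_chain; [exact: effect_swap | exact: eG].
apply: effect_chain; first exact: effect_swap.
by rewrite /= -catA; exact: effect_push_main.
Qed.

Definition is_leaf t := if t is Leaf then true else false.

Lemma tree_if c f g : tree_computable c -> tree_computable f ->
  tree_computable g ->
  tree_computable (fun t => if is_leaf (c t) then f t else g t).
Proof.
move=> [C eC] [F eF] [G eG].
exists (chain (chain dup C) (top Main (fun o =>
  if o is Some Tick then chain (chain (take_tree StackA) (clear StackA)) G
  else chain (pop Main) F))) => t u.
apply: effect_chain.
  by apply: effect_chain; [exact: effect_dup | exact: eC].
apply: effect_top; case: (c t) => [|x y] /=.
  by apply: effect_chain; [exact: effect_pop_main | exact: eF].
apply: (effect_chain _ (eG _ _)).
apply: effect_chain.
  exact: (@effect_take_A (Node x y)).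
exact: effect_clear_A.
Qed.

Fixpoint tree_foldl (f : tree -> tree) c l z :=
  if l is Node x l' then tree_foldl f c l' (f (Node c (Node x z))) else z.

(** The loop keeps the rest of the list on top, without the letter of the node
    that ties it to the other values, so that it ends when a leaf is on top. *)
Lemma tree_foldlP f c l z : tree_computable f -> tree_computable c ->
  tree_computable l -> tree_computable z ->
  tree_computable (fun t => tree_foldl f (c t) (l t) (z t)).
Proof.
move=> cf cc cl cz.
pose rest := tree_right \o tree_left.
pose item := tree_left \o tree_left.
pose ctx := tree_left \o tree_right.
pose value := tree_right \o tree_right.
have [G eG] : tree_computable (fun t => Node (rest t)
    (Node (ctx t) (f (Node (ctx t) (Node (item t) (value t)))))).
  have [crest citem cctx cvalue] : [/\ tree_computable rest,
      tree_computable item, tree_computable ctx & tree_computable value].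
    by split; apply: tree_comp; exact: tree_leftP || exact: tree_rightP.
  apply: tree_node => //; apply: tree_node => //.
  by apply: (tree_comp cf); apply: tree_node => //; exact: tree_node.
pose L := chain (pop Main) (chain (while_top Main Tick
  (chain (push Main Tick) (chain G (pop Main)))) (push Main Tick)).
have loop : tree_computable (fun t =>
    value (Node Leaf (Node (c t) (tree_foldl f (c t) (l t) (z t))))).
  apply: (tree_comp (f := value) (g := fun t =>
    Node Leaf (Node (c t) (tree_foldl f (c t) (l t) (z t))))).
    by apply: tree_comp; exact: tree_rightP.
  have [P eP] : tree_computable (fun t => Node (l t) (Node (c t) (z t))).
    by apply: tree_node => //; exact: tree_node.
  exists (chain P L) => t u; apply: effect_chain; first exact: eP.
  rewrite [code (Node _ _) ++ u]/= -catA.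
  apply: effect_chain; first exact: effect_pop_main.
  apply: (effect_chain (st1 := stacks (code Leaf ++
    code (Node (c t) (tree_foldl f (c t) (l t) (z t))) ++ u) [::] [::]));
    last by apply: effect_eq; [exact: effect_push_main | case].
  elim: (l t) (z t) => [|x _ l' IH] z'.
    exact: effect_while_stop.
  apply: effect_while_step; [by [] | | exact: IH].
  apply: effect_chain; first exact: effect_push_main.
  have := eG (Node (Node x l') (Node (c t) z')) u; rewrite /= -!catA /= -!catA => eGt.
  by apply: effect_chain; [exact: eGt | exact: effect_pop_main].
exact: tree_ext loop.
Qed.

(** * Words as input and output *)

(** The word is reversed first, because the tree of a list is built from its last
    letter. *)
Definition load : flow I S :=
  chain (chain (pour StackA StackB) (push Main EndInt))
    (each StackB (fun a =>
       chain (push_word (code (encode a))) (push Main Tick))).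

Lemma effect_load w :
  effect load (stacks [::] w [::]) (stacks (code (encode w)) [::] [::]).
Proof.
apply: (effect_chain (st1 := stacks (code (encode ([::] : seq letter))) [::] (rev w))).
  apply: effect_chain; first exact: effect_pour.
  by apply: effect_eq; [exact: effect_push | case].
have loop v s : effect (each StackB (fun a =>
    chain (push_word (code (encode a))) (push Main Tick)))
    (stacks (code (encode s)) [::] v) (stacks (code (encode (catrev v s))) [::] [::]).
  elim: v s => [|a v IH] s; first exact: effect_each_nil.
  apply: effect_each_cons => //; last exact: IH.
  apply: (@effect_from _ _ (stacks (code (encode s)) [::] v)); first by case.
  by apply: effect_chain; [exact: effect_push_word | exact: effect_push_main].
by have := loop (rev w) [::]; rewrite catrevE revK cats0.
Qed.

(** The code of a letter is a unary number: [Tick; EndInt] for each unit, then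
    [EndInt]. *)
Fixpoint unload_letter (s : seq letter) : flow I S :=
  if s is a :: s' then
    top Main (fun o => if o is Some Tick
      then chain (chain (pop Main) (pop Main)) (unload_letter s')
      else chain (pop Main) (push StackA a))
  else skip I S.

Definition unload : flow I S :=
  chain (while_top Main Tick (chain (pop Main)
          (unload_letter [:: Tick; Minus; EndInt; EndVec; EndSet])))
        (pour StackA Output).

Lemma effect_unload_letter a m w :
  effect (unload_letter [:: Tick; Minus; EndInt; EndVec; EndSet])
    (stacks (code (encode a) ++ m) w [::]) (stacks m (a :: w) [::]).
Proof.
have last_step b : effect (chain (pop Main) (push StackA b))
    (stacks (EndInt :: m) w [::]) (stacks m (b :: w) [::]).
  apply: effect_chain; first exact: effect_pop_main.
  by apply: effect_eq; [exact: effect_push | case].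
case: a; do ![by apply: effect_top; exact: last_step
  | apply: effect_top; apply: effect_chain;
      first by apply: effect_chain; exact: effect_pop_main].
Qed.

Lemma effect_unload w : effect unload (stacks (code (encode w)) [::] [::])
  (upd (stacks (code Leaf) [::] [::]) Output w).
Proof.
apply: (effect_chain (st1 := stacks (code Leaf) (rev w) [::])); last first.
  apply: effect_eq; first exact: effect_pour.
  by case=> //=; rewrite catrevE cats0 revK.
have loop v : effect (while_top Main Tick (chain (pop Main)
    (unload_letter [:: Tick; Minus; EndInt; EndVec; EndSet])))
    (stacks (code (encode w)) v [::]) (stacks (code Leaf) (catrev w v) [::]).
  elim: w v => [|a w IH] v; first exact: effect_while_stop.
  apply: effect_while_step; [by [] | | exact: IH].
  by apply: effect_chain; [exact: effect_pop_main | exact: effect_unload_letter].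
exact: loop.
Qed.

(** * Computable functions on encoded data *)

Definition computable A B {encA : encodable A} {encB : encodable B}
    (f : A -> B) : Prop :=
  exists2 g, tree_computable g & forall a, g (encode a) = encode (f a).

(** The value of [f] ends up on the first tape of [M], where [M] finds it as if
    it were its input, while the other tapes of [M] are still blank. *)
Lemma computable_reduction (f : seq letter -> seq letter) : computable f ->
  exists N : turing_machine, forall w,
    (halts M (f w) -> halts N w) /\ (accepts N w <-> accepts M (f w)).
Proof.
case=> g [G eG] gf.
exists (@prefix_machine M 3 (chain (chain load G) unload)) => w.
have eF : effect (chain (chain load G) unload) (stacks [::] w [::])
    (upd (stacks (code Leaf) [::] [::]) Output (f w)).
  apply: effect_chain; last exact: effect_unload.
  apply: effect_chain; first exact: effect_load.
  by have := eG (@encode _ (seq_encodable letter_encodable) w) [::]; rewrite !cats0 gf.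
have [|T' rT' [hr hM]] := effectP eF (T := config_tapes
    (init_config (prefix_machine (chain (chain load G) unload)) w)).
  split=> [r|j j0]; last by rewrite !ffunE.
  exists 0%N => //; rewrite ffunE.
  have -> : (tape_of r == ord0 :> 'I_(3 + e.+1).+1) =
      (if r is StackA then true else false).
    by case: r; rewrite -val_eqE /= ?inordK.
  by case: r.
apply: (prefix_correct rT'); apply/ffunP=> j; rewrite !ffunE.
have [->|j0] := eqVneq j ord0; last exact: hM.
by have [p E p0] := hr Output; rewrite [T' _]E p0.
Qed.

(** ** Closure properties *)

Section Closure.
Variables (X A B C : Type) (encX : encodable X) (encA : encodable A).
Variables (encB : encodable B) (encC : encodable C).

Lemma comp_id : computable (fun x : X => x).
Proof. by exists id => //; exact: tree_id. Qed.

Lemma comp_const (b : B) : computable (fun _ : X => b).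
Proof. by exists (fun=> encode b) => //; exact: tree_const. Qed.

Lemma comp_ext (f g : X -> B) : computable f -> f =1 g -> computable g.
Proof. by move=> cf /funext<-. Qed.

Lemma comp_comp (g : B -> C) (f : X -> B) :
  computable g -> computable f -> computable (fun x => g (f x)).
Proof.
move=> [tg cg Eg] [tf cf Ef]; exists (tg \o tf); first exact: tree_comp.
by move=> x; rewrite /= Ef Eg.
Qed.

Lemma comp_pair (f : X -> A) (g : X -> B) :
  computable f -> computable g -> computable (fun x => (f x, g x)).
Proof.
move=> [tf cf Ef] [tg cg Eg]; exists (fun t => Node (tf t) (tg t)).
  exact: tree_node.
by move=> x; rewrite Ef Eg.
Qed.

Lemma comp_fst (f : X -> A * B) : computable f -> computable (fun x => (f x).1).
Proof.
move=> [tf cf Ef]; exists (tree_left \o tf); first exact: tree_comp tree_leftP _.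
by move=> x; rewrite /= Ef.
Qed.

Lemma comp_snd (f : X -> A * B) : computable f -> computable (fun x => (f x).2).
Proof.
move=> [tf cf Ef]; exists (tree_right \o tf); first exact: tree_comp tree_rightP _.
by move=> x; rewrite /= Ef.
Qed.

Lemma comp_if (b : X -> bool) (f g : X -> B) :
  computable b -> computable f -> computable g ->
  computable (fun x => if b x then f x else g x).
Proof.
move=> [tb cb Eb] [tf cf Ef] [tg cg Eg].
exists (fun t => if is_leaf (tb t) then tf t else tg t); first exact: tree_if.
by move=> x; rewrite Eb; case: (b x); rewrite /= ?Ef ?Eg.
Qed.

Lemma comp_cons (f : X -> A) (s : X -> seq A) :
  computable f -> computable s -> computable (fun x => f x :: s x).
Proof.
move=> [tf cf Ef] [ts cs Es]; exists (fun t => Node (tf t) (ts t)).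
  exact: tree_node.
by move=> x; rewrite Ef Es.
Qed.

Lemma comp_case_seq (s : X -> seq A) (n : X -> B) (c : X -> A -> seq A -> B) :
  computable s -> computable n ->
  computable (fun p : X * (A * seq A) => c p.1 p.2.1 p.2.2) ->
  computable (fun x => if s x is a :: l then c x a l else n x).
Proof.
move=> [ts cs Es] [tn cn En] [tc cc Ec].
exists (fun t => if is_leaf (ts t) then tn t else tc (Node t (ts t))).
  apply: tree_if => //; apply: (tree_comp cc); apply: tree_node => //.
  exact: tree_id.
move=> x; rewrite Es; case: (s x) => [|a l]; first by rewrite /= En.
by rewrite /= -(Ec (x, (a, l))).
Qed.

Lemma comp_foldr (s : X -> seq A) (z : X -> B) (f : X -> A -> B -> B) :
  computable s -> computable z ->
  computable (fun p : X * (A * B) => f p.1 p.2.1 p.2.2) ->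
  computable (fun x => foldr (f x) (z x) (s x)).
Proof.
move=> [ts cs Es] [tz cz Ez] [tf cf Ef].
(* The inner fold reverses the list: [tree_foldl] starts from the head. *)
exists (fun t => tree_foldl tf (id t)
    (tree_foldl tree_right Leaf (ts t) Leaf) (tz t)).
  apply: tree_foldlP => //; first exact: tree_id.
  apply: tree_foldlP => //; try exact: tree_const.
  exact: tree_rightP.
move=> x; rewrite Es Ez.
have E1 (v v' : seq A) : tree_foldl tree_right Leaf (encode v) (encode v')
    = encode (catrev v v').
  by elim: v v' => // a v IH v'; exact: (IH (a :: v')).
rewrite (E1 _ [::]) -[s x in RHS]revK -[catrev _ _]/(rev _).
rewrite -[foldr _ _ _]/(foldr (fun a => f x a) _ _) -foldl_rev revK.
elim: (rev (s x)) (z x) => //= a v IH z'.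
by rewrite -IH -(Ef (x, (a, z'))).
Qed.

Lemma comp_iter (n : X -> nat) (z : X -> B) (f : X -> B -> B) :
  computable n -> computable z -> computable (fun p : X * B => f p.1 p.2) ->
  computable (fun x => iter (n x) (f x) (z x)).
Proof.
move=> [tn cn En] [tz cz Ez] [tf cf Ef].
exists (fun t => tree_foldl
  (fun t => tf (Node (tree_left t) (tree_right (tree_right t)))) (id t) (tn t) (tz t)).
  apply: tree_foldlP => //; last exact: tree_id.
  apply: (tree_comp cf); apply: tree_node; first exact: tree_leftP.
  by apply: tree_comp; exact: tree_rightP.
move=> x; rewrite En Ez; elim: (n x) (z x) => // m IH z'.
by rewrite iterSr -IH /= -(Ef (x, z')).
Qed.

Lemma comp_succ (n : X -> nat) : computable n -> computable (fun x => (n x).+1).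
Proof.
move=> [tn cn En]; exists (fun t => Node Leaf (tn t)).
  by apply: tree_node => //; exact: tree_const.
by move=> x; rewrite En.
Qed.

Lemma comp_case_nat (n : X -> nat) (z : X -> B) (f : X -> nat -> B) :
  computable n -> computable z -> computable (fun p : X * nat => f p.1 p.2) ->
  computable (fun x => if n x is m.+1 then f x m else z x).
Proof.
move=> [tn cn En] [tz cz Ez] [tf cf Ef].
exists (fun t => if is_leaf (tn t) then tz t else tf (Node t (tree_right (tn t)))).
  apply: tree_if => //; apply: (tree_comp cf); apply: tree_node.
    exact: tree_id.
  exact: tree_comp tree_rightP _.
move=> x; rewrite En; case: (n x) => [|m]; first by rewrite /= Ez.
by rewrite /= -(Ef (x, m)).
Qed.

Lemma comp_Posz (n : X -> nat) : computable n -> computable (fun x => Posz (n x)).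
Proof.
move=> [tn cn En]; exists (fun t => Node Leaf (tn t)).
  by apply: tree_node => //; exact: tree_const.
by move=> x; rewrite En.
Qed.

Lemma comp_Negz (n : X -> nat) : computable n -> computable (fun x => Negz (n x)).
Proof.
move=> [tn cn En]; exists (fun t => Node (Node Leaf Leaf) (tn t)).
  by apply: tree_node => //; exact: tree_const.
by move=> x; rewrite En.
Qed.

Lemma comp_case_int (z : X -> int) (f g : X -> nat -> B) :
  computable z -> computable (fun p : X * nat => f p.1 p.2) ->
  computable (fun p : X * nat => g p.1 p.2) ->
  computable (fun x => match z x with Posz n => f x n | Negz n => g x n end).
Proof.
move=> [tz cz Ez] [tf cf Ef] [tg cg Eg].
have cn : tree_computable (fun t => Node t (tree_right (tz t))).
  by apply: tree_node; [exact: tree_id | exact: tree_comp tree_rightP _].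
exists (fun t => if is_leaf (tree_left (tz t)) then tf (Node t (tree_right (tz t)))
   else tg (Node t (tree_right (tz t)))).
  apply: tree_if; first exact: tree_comp tree_leftP _.
    exact: tree_comp cf cn.
  exact: tree_comp cg cn.
move=> x; rewrite Ez; case: (z x) => n.
  by rewrite /= -(Ef (x, n)).
by rewrite /= -(Eg (x, n)).
Qed.

Lemma comp_letter (a : X -> letter) (f : letter -> X -> B) :
  computable a -> (forall l, computable (f l)) -> computable (fun x => f (a x) x).
Proof.
move=> [ta ca Ea] cf; have [f0 c0 E0] := cf Tick; have [f1 c1 E1] := cf Minus.
have [f2 c2 E2] := cf EndInt; have [f3 c3 E3] := cf EndVec.
have [f4 c4 E4] := cf EndSet.
pose down n t := iter n tree_right (ta t).
have cdown n : tree_computable (down n).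
  by elim: n => // n IH; exact: tree_comp tree_rightP IH.
exists (fun t => if is_leaf (down 0 t) then f0 t else
  if is_leaf (down 1 t) then f1 t else if is_leaf (down 2 t) then f2 t else
  if is_leaf (down 3 t) then f3 t else f4 t)%N; first by do 4!apply: tree_if => //.
by move=> x; rewrite /down Ea; case: (a x);
  rewrite /= ?E0 ?E1 ?E2 ?E3 ?E4.
Qed.

End Closure.

End Stacks.
(** * Arithmetic, lists and words *)

(** Computability of terms built from constructors and projections. *)
Ltac comp := repeat first [ assumption | cbv beta; lazymatch goal with
  | |- computable _ (fun x => x) => exact: comp_id
  | |- computable _ (fun x => (@?f x).1) => refine (comp_fst (f := f) _)
  | |- computable _ (fun x => (@?f x).2) => refine (comp_snd (f := f) _)
  | |- computable _ fst => refine (comp_fst (f := fun x => x) _)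
  | |- computable _ snd => refine (comp_snd (f := fun x => x) _)
  | |- computable _ (fun x => (@?f x, @?g x)) =>
      refine (comp_pair (f := f) (g := g) _ _)
  | |- computable _ (fun x => @?f x :: @?s x) =>
      refine (comp_cons (f := f) (s := s) _ _)
  | |- computable _ (cons ?a) =>
      refine (comp_cons (f := fun=> a) (s := fun x => x) _ _)
  | |- computable _ (fun x => (@?n x).+1) => refine (comp_succ (n := n) _)
  | |- computable _ (fun x => Posz (@?n x)) => refine (comp_Posz (n := n) _)
  | |- computable _ (fun x => Negz (@?n x)) => refine (comp_Negz (n := n) _)
  | |- computable _ (fun x => ?g (@?f x)) =>
      first [ refine (comp_comp (g := g) (f := f) _ _); first assumption
            | exact: comp_const ]
  | |- computable _ (fun x => _) => exact: comp_const
  end ].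

Section Library.
Variable M : turing_machine.
Local Notation computable := (computable M).

Lemma comp_comp2 X A B C (encX : encodable X) (encA : encodable A)
    (encB : encodable B) (encC : encodable C) (h : A -> B -> C) (f : X -> A)
    (g : X -> B) :
  computable (fun p : A * B => h p.1 p.2) -> computable f -> computable g ->
  computable (fun x => h (f x) (g x)).
Proof. by move=> ch cf cg; exact: (comp_comp ch (comp_pair cf cg)). Qed.

Lemma comp_add X (encX : encodable X) (m n : X -> nat) :
  computable m -> computable n -> computable (fun x => m x + n x)%N.
Proof.
move=> cm cn; apply: (comp_ext (f := fun x => iter (m x) succn (n x))).
  by apply: (comp_iter (f := fun=> succn)); comp.
by move=> x; elim: (m x) => //= k ->.
Qed.

Lemma comp_mul X (encX : encodable X) (m n : X -> nat) :
  computable m -> computable n -> computable (fun x => m x * n x)%N.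
Proof.
move=> cm cn; apply: (comp_ext (f := fun x => iter (m x) (addn (n x)) 0%N)).
  by apply: (comp_iter (f := fun x => addn (n x))); comp; apply: comp_add; comp.
by move=> x; elim: (m x) => //= k ->.
Qed.

Lemma comp_sub X (encX : encodable X) (m n : X -> nat) :
  computable m -> computable n -> computable (fun x => m x - n x)%N.
Proof.
move=> cm cn; apply: (comp_ext (f := fun x => iter (n x) predn (m x))).
  apply: (comp_iter (f := fun=> predn)); comp.
  by apply: (comp_case_nat (f := fun _ m => m)); comp.
by move=> x; elim: (n x) => /= [|k ->]; rewrite ?subn0 // subnS.
Qed.

Lemma comp_leq X (encX : encodable X) (m n : X -> nat) :
  computable m -> computable n -> computable (fun x => m x <= n x)%N.
Proof.
move=> cm cn; apply: (comp_ext
  (f := fun x => if (m x - n x)%N is _.+1 then false else true)).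
  by apply: (comp_case_nat (f := fun _ _ => false)); comp; exact: comp_sub.
by move=> x; rewrite /leq; case: (m x - n x)%N.
Qed.

Lemma comp_cat X A (encX : encodable X) (encA : encodable A) (s t : X -> seq A) :
  computable s -> computable t -> computable (fun x => s x ++ t x).
Proof.
move=> cs ct; apply: (comp_ext (f := fun x => foldr cons (t x) (s x))).
  by apply: (comp_foldr (f := fun=> cons)); comp.
by move=> x; elim: (s x) => //= a v ->.
Qed.

Lemma comp_map X A B (encX : encodable X) (encA : encodable A)
    (encB : encodable B) (f : X -> A -> B) (s : X -> seq A) :
  computable (fun p : X * A => f p.1 p.2) -> computable s ->
  computable (fun x => map (f x) (s x)).
Proof.
move=> cf cs.
apply: (comp_foldr (f := fun x a => cons (f x a)) (z := fun=> [::]) cs); comp.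
by apply: (comp_comp2 cf); comp.
Qed.

Lemma comp_flatten X A (encX : encodable X) (encA : encodable A)
    (s : X -> seq (seq A)) :
  computable s -> computable (fun x => flatten (s x)).
Proof.
move=> cs; apply: (comp_foldr (f := fun=> cat) (z := fun=> [::]) cs); comp.
by apply: comp_cat; comp.
Qed.

Lemma comp_sumn X (encX : encodable X) (s : X -> seq nat) :
  computable s -> computable (fun x => sumn (s x)).
Proof.
move=> cs; apply: (comp_foldr (f := fun=> addn) (z := fun=> 0%N) cs); comp.
by apply: comp_add; comp.
Qed.

Lemma comp_size X A (encX : encodable X) (encA : encodable A) (s : X -> seq A) :
  computable s -> computable (fun x => size (s x)).
Proof.
move=> cs; apply: (comp_ext (f := fun x => foldr (fun=> succn) 0%N (s x))).
  by apply: (comp_foldr (f := fun _ _ => succn) (z := fun=> 0%N) cs); comp.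
by move=> x; elim: (s x) => //= a v ->.
Qed.

Lemma comp_nseq X A (encX : encodable X) (encA : encodable A) (n : X -> nat) (a : A) :
  computable n -> computable (fun x => nseq (n x) a).
Proof. by move=> cn; apply: (comp_iter (f := fun=> cons a)); comp. Qed.

Lemma comp_nth X A (encX : encodable X) (encA : encodable A) a0 (s : X -> seq A) k :
  computable s -> computable (fun x => nth a0 (s x) k).
Proof.
move=> cs; apply: (comp_comp (g := fun t => nth a0 t k)) cs.
elim: k => [|k IH].
  apply: (comp_ext (f := fun s => if s is a :: l then a else a0)); last by case.
  by apply: (comp_case_seq (c := fun _ a _ => a)); comp.
apply: (comp_ext (f := fun s => if s is a :: l then nth a0 l k else a0)); last by case.
apply: (comp_case_seq (c := fun _ _ l => nth a0 l k)); comp.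
by apply: (comp_comp IH); comp.
Qed.

Definition map_head A (f : A -> A) (s : seq A) :=
  if s is a :: l then f a :: l else [::].

Lemma comp_map_head A (encA : encodable A) (f : A -> A) :
  computable f -> computable (map_head f).
Proof.
move=> cf; apply: (comp_case_seq (s := id) (c := fun _ a l => f a :: l)); comp.
Qed.

(** ** Integers *)

Lemma comp_succz : computable (fun z : int => (z + 1)%R).
Proof.
apply: (comp_ext (f := fun z : int => match z with
  | Posz n => Posz n.+1
  | Negz n => if n is n'.+1 then Negz n' else Posz 0
  end)).
  apply: (comp_case_int (f := fun _ n => Posz n.+1)
    (g := fun _ n => if n is n'.+1 then Negz n' else Posz 0)); comp.
  by apply: (comp_case_nat (f := fun _ n' => Negz n')); comp.
by case=> [n|[|n]]; lia.
Qed.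

Lemma comp_predz : computable (fun z : int => (z - 1)%R).
Proof.
apply: (comp_ext (f := fun z : int => match z with
  | Posz n => if n is n'.+1 then Posz n' else Negz 0
  | Negz n => Negz n.+1
  end)).
  apply: (comp_case_int (g := fun _ n => Negz n.+1)
    (f := fun _ n => if n is n'.+1 then Posz n' else Negz 0)); comp.
  by apply: (comp_case_nat (f := fun _ n' => Posz n')); comp.
by case=> [[|n]|n]; lia.
Qed.

Lemma comp_addz (c : int) : computable (fun z : int => (z + c)%R).
Proof.
case: c => n.
  elim: n => [|n IH].
    by apply: comp_ext (comp_id _ _) _ => z /=; lia.
  by apply: comp_ext (comp_comp comp_succz IH) _ => z /=; lia.
elim: n => [|n IH]; first by apply: comp_ext comp_predz _ => z /=; lia.
by apply: comp_ext (comp_comp comp_predz IH) _ => z /=; lia.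
Qed.

Lemma comp_oppz : computable (fun z : int => (- z)%R).
Proof.
apply: (comp_ext (f := fun z : int => match z with
  | Posz n => if n is n'.+1 then Negz n' else Posz 0
  | Negz n => Posz n.+1
  end)).
  apply: (comp_case_int (g := fun _ n => Posz n.+1)
    (f := fun _ n => if n is n'.+1 then Negz n' else Posz 0)); comp.
  by apply: (comp_case_nat (f := fun _ n' => Negz n')); comp.
by case=> [[|n]|n]; lia.
Qed.

Lemma comp_absz : computable absz.
Proof.
apply: (comp_ext (f := fun z : int =>
  match z with Posz n => n | Negz n => n.+1 end)); last by case.
by apply: (comp_case_int (f := fun _ n => n) (g := fun _ n => n.+1)); comp.
Qed.

(** ** Vectors and families of lists of vectors *)

Section Vectors.
Variable d : nat.
Local Notation vec := 'rV[int]_d.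
Local Open Scope ring_scope.
Implicit Types (v u : vec) (Fs : seq (seq vec)).

Definition coords v : seq int := [seq v ord0 i | i <- enum 'I_d].

Definition of_coords (s : seq int) : vec := \row_i nth 0 s i.

#[export] Instance vec_encodable : encodable vec := fun v => encode (coords v).

Lemma coordsK : cancel coords of_coords.
Proof.
move=> v; apply/rowP=> i; rewrite mxE (nth_map i) ?size_enum_ord //.
by rewrite nth_ord_enum.
Qed.

Lemma comp_coords X (encX : encodable X) (f : X -> vec) :
  computable (fun x => coords (f x)) -> computable f.
Proof. by []. Qed.

Lemma coords_comp : computable coords.
Proof. exact: (comp_id M vec_encodable). Qed.

Lemma of_coords_comp : computable of_coords.
Proof.
apply: comp_coords.
apply: (comp_ext (f := fun s => [seq nth 0 s k | k <- map val (enum 'I_d)])).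
  elim: (map _ _) => [|k ks IH]; first exact: comp_const.
  by apply: comp_cons; [apply: comp_nth; comp | exact: IH].
by move=> s; rewrite -map_comp; apply: eq_map => i; rewrite /= mxE.
Qed.

Lemma comp_coord (i : 'I_d) : computable (fun v => v ord0 i).
Proof.
apply: (comp_ext (f := fun v => nth 0 (coords v) i)).
  by apply: comp_nth; exact: coords_comp.
by move=> v; rewrite (nth_map i) ?size_enum_ord // nth_ord_enum.
Qed.

Fixpoint add_coords (us s : seq int) : seq int :=
  if us is c :: us' then if s is z :: s' then z + c :: add_coords us' s' else [::]
  else [::].

Lemma add_coords_comp us : computable (add_coords us).
Proof.
elim: us => [|c us IH]; first exact: comp_const.
apply: (comp_case_seq (s := fun s => s) (n := fun=> [::])
  (c := fun _ z s' => z + c :: add_coords us s')); comp.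
by apply: (comp_comp (comp_addz c)); comp.
Qed.

Lemma comp_translate u : computable (fun v => v + u).
Proof.
apply: comp_coords.
apply: (comp_ext (f := fun v => add_coords (coords u) (coords v))).
  exact: comp_comp (add_coords_comp _) coords_comp.
by move=> v; rewrite /coords; elim: (enum 'I_d) => //= i s ->; rewrite mxE.
Qed.

(** Words are read from right to left, so that the terminator of an item is met
    before its content and the sign of an integer after its absolute value; the
    item that is being read is always the head. *)
Definition parse_step (a : letter) : seq (seq (seq int)) -> seq (seq (seq int)) :=
  match a with
  | EndSet => cons [::]
  | EndVec => map_head (cons [::])
  | EndInt => map_head (map_head (cons 0))
  | Tick => map_head (map_head (map_head (fun z => z + 1)))
  | Minus => map_head (map_head (map_head (fun z => - z)))
  end.

Definition parse_lists (w : seq letter) : seq (seq vec) :=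
  map (map of_coords) (foldr parse_step [::] w).

Definition print_lists Fs : seq letter := flatten [seq enc_list s | s <- Fs].

Lemma parse_int z (s : seq int) F Gs :
  foldr parse_step ((s :: F) :: Gs) (enc_int z) = ((z :: s) :: F) :: Gs.
Proof.
have ticks n : foldr parse_step ((s :: F) :: Gs) (nseq n Tick ++ [:: EndInt]) =
    ((Posz n :: s) :: F) :: Gs.
  by elim: n => //= n ->; rewrite /= -addn1 PoszD.
by case: z => n; [exact: ticks | exact: (congr1 (parse_step Minus) (ticks n.+1))].
Qed.

Lemma parse_vec v F Gs :
  foldr parse_step (F :: Gs) (enc_vec v) = (coords v :: F) :: Gs.
Proof.
rewrite /enc_vec foldr_cat /= /coords; elim: (enum 'I_d) => //= i s IH.
by rewrite foldr_cat IH parse_int.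
Qed.

Lemma parse_list s Gs :
  foldr parse_step Gs (enc_list s) = map coords s :: Gs.
Proof.
rewrite /enc_list foldr_cat /=; elim: s => //= v s IH.
by rewrite foldr_cat IH parse_vec.
Qed.

Lemma print_listsK : cancel print_lists parse_lists.
Proof.
move=> Fs; rewrite /parse_lists /print_lists.
have -> : foldr parse_step [::] (flatten [seq enc_list s | s <- Fs]) =
    map (map coords) Fs.
  by elim: Fs => //= s Fs IH; rewrite foldr_cat IH parse_list.
rewrite -map_comp -[RHS]map_id; apply: eq_map => s /=.
by rewrite -map_comp -[RHS]map_id; apply: eq_map => v /=; exact: coordsK.
Qed.

Lemma enc_vec_inj : injective (@enc_vec d).
Proof.
move=> v w E; have := parse_vec w [::] [::]; rewrite -E parse_vec => -[].
exact: (can_inj coordsK).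
Qed.

Lemma parse_lists_comp : computable parse_lists.
Proof.
apply: (comp_map (f := fun=> map of_coords)).
  apply: (comp_map (f := fun=> of_coords)); last by comp.
  by apply: (comp_comp of_coords_comp); comp.
apply: (comp_foldr (f := fun=> parse_step)); comp.
apply: (comp_letter (f := fun a p => parse_step a p.2.2)); comp.
case; rewrite /parse_step; apply: (comp_comp (f := fun p => p.2.2));
  try by comp.
- by do !apply: comp_map_head; exact: comp_addz.
- by do !apply: comp_map_head; exact: comp_oppz.
- by do !apply: comp_map_head; comp.
by apply: comp_map_head; comp.
Qed.

Lemma enc_int_comp : computable enc_int.
Proof.
apply: comp_cat; last by comp.
apply: (comp_case_int (f := fun _ n => nseq n Tick)
  (g := fun _ n => Minus :: nseq n.+1 Tick)); comp; apply: comp_nseq; comp.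
Qed.

Lemma enc_vec_comp : computable (@enc_vec d).
Proof.
apply: comp_cat; last by comp.
apply: (comp_ext (f := fun v => flatten (map enc_int (coords v)))).
  apply: comp_flatten; apply: (comp_map (f := fun=> enc_int)).
    by apply: (comp_comp enc_int_comp); comp.
  exact: coords_comp.
by move=> v; rewrite -map_comp.
Qed.

Lemma print_lists_comp : computable print_lists.
Proof.
apply: comp_flatten; apply: (comp_map (f := fun=> @enc_list d)); comp.
apply: comp_cat; comp; apply: comp_flatten.
apply: (comp_map (f := fun=> @enc_vec d)); comp.
by apply: (comp_comp enc_vec_comp); comp.
Qed.

End Vectors.

End Library.

(** * Jigsaw pieces on the line *)

Section Line.
Local Open Scope ring_scope.
Variable m : int.

(** The interval from 0 to [m], with a dent at [a] and a bump at [a + m]: a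
    complete system of residues modulo [m]. *)
Definition piece (a b : int) : Prop := (0 <= b < m /\ b <> a) \/ b = a + m.

Variable P : int -> int -> Prop.
Hypothesis P_bound : forall a c, P a c -> 2 <= a /\ 4 * a + 16 <= m.
Hypothesis P_cover : forall t : int, exists a c, P a c /\ piece a (t - c).
Hypothesis P_disjoint : forall t a c b e : int, P a c -> P b e ->
  piece a (t - c) -> piece b (t - e) -> a = b /\ c = e.

(** The bodies of the two pieces overlap in at least three cells. The first two of
    them cannot be the dent of the piece on the right, since dents are not at 0
    or 1, and at most one of them is the dent of the other piece. *)
Lemma close_pieces a c b e :
  P a c -> P b e -> `|c - e| <= m - 3 -> a = b /\ c = e.
Proof.
wlog le_ce : a c b e / c <= e => [wl Pa Pb ce|].
  have [le_ce|/ltW le_ec] := lerP c e; first exact: wl.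
  by have [|-> ->] := wl _ _ _ _ le_ec Pb Pa; first by rewrite distrC.
move=> Pa Pb ce; have [[a2 am] [b2 bm]] := (P_bound Pa, P_bound Pb).
have [ea|ne] := eqVneq e (c + a).
  by apply: (P_disjoint (t := e + 1) Pa Pb); left; lia.
by apply: (P_disjoint (t := e) Pa Pb); left; move/eqP: ne; lia.
Qed.

(** The dent can only be filled by the bump of a piece of the same kind. *)
Lemma previous_piece a c : P a c -> P a (c - m).
Proof.
move=> Pa; have [a2 am] := P_bound Pa.
(* The piece that fills the dent. *)
have [b [e [Pb cb]]] := P_cover (c + a); have [b2 bm] := P_bound Pb.
have far : ~ `|c - e| <= m - 3.
  move=> /(close_pieces Pa Pb)[ab ce]; case: cb; lia.
have {cb far} [lab ee] : a <= b /\ e = c + a - b - m.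
  case: cb => [cb|cb]; first by lia.
  split; last by lia.
  rewrite leNgt; apply/negP=> lt_ba.
  suff : a = b /\ c = e by lia.
  by apply: (P_disjoint (t := c) Pa Pb); left; lia.
have [ab|nab] := eqVneq a b; first by rewrite ab (_ : c - m = e) //; lia.
(* If [a < b], there is a gap before [c], and the piece that covers its last cell
   is close to one of the two pieces that bound it. *)
have [g [h [Pg cg]]] := P_cover (c - 1); have [g2 gm] := P_bound Pg.
have far1 : `|c - h| <= m - 3 -> a = g /\ c = h by exact: close_pieces.
have far2 : `|e - h| <= m - 3 -> b = g /\ e = h by exact: close_pieces.
by move/eqP: nab; case: cg; lia.
Qed.

Lemma previous_pieces a c (n : nat) : P a c -> P a (c - n%:Z * m).
Proof.
move=> Pa; elim: n => [|n IH]; first by rewrite mul0r subr0.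
by rewrite (_ : _ - _ = c - n%:Z * m - m); [exact: previous_piece | lia].
Qed.

(** Both kinds recur to the left with period [m], so some pieces of the two kinds
    are close to each other. *)
Lemma single_piece a c b e : P a c -> P b e -> a = b.
Proof.
wlog le_ec : a c b e / e <= c => [wl Pa Pb|Pa Pb].
  have [le_ec|/ltW le_ce] := lerP e c; first exact: wl le_ec Pa Pb.
  by symmetry; exact: wl le_ce Pb Pa.
have [a2 am] := P_bound Pa.
have [q [r [Eq r0 rm]]] : exists q : nat, exists r : int,
    [/\ c - e = q%:Z * m + r, 0 <= r & r < m].
  exists `|((c - e) %/ m)%Z|%N, ((c - e) %% m)%Z.
  have m0 : 0 < m by lia.
  have q0 : 0 <= ((c - e) %/ m)%Z by rewrite divz_ge0 //; lia.
  rewrite gez0_abs // -divz_eq; split=> //; last exact: ltz_pmod.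
  by apply: modz_ge0; lia.
(* The piece at distance [r], or else the one before it, is close enough. *)
have [le_r|lt_r] := lerP r (m - 3).
  have [] // := close_pieces (previous_pieces q Pa) Pb.
  by rewrite (_ : _ - e = r); lia.
have [] // := close_pieces (previous_pieces q.+1 Pa) Pb.
by rewrite (_ : _ - e = r - m); lia.
Qed.

End Line.

(** * Tilings modulo a subgroup *)

Section Tiles.
Variables (d k : nat).
Local Notation vec := 'rV[int]_d.
Local Open Scope ring_scope.
Implicit Types (H : vec -> Prop) (F A : 'I_k -> vec -> Prop).

Definition subgroup H := H 0 /\ forall x y, H x -> H y -> H (x - y).

(** Tiling of the quotient by [H], in terms of representatives: [F] and [A] stand
    for their images, and several of their elements may have the same image. *)
Definition tiles H F : Prop := exists A,
  (forall x, exists j f a, [/\ F j f, A j a & H (x - (f + a))]) /\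
  (forall j f a j' f' a', F j f -> A j a -> F j' f' -> A j' a' ->
     H (f + a - (f' + a')) -> j = j' /\ H (f - f')).

Lemma subgroupN H x : subgroup H -> H x -> H (- x).
Proof. by case=> H0 HB Hx; rewrite -sub0r; exact: HB. Qed.

Lemma subgroupD H x y : subgroup H -> H x -> H y -> H (x + y).
Proof. by move=> HH Hx Hy; rewrite -[y]opprK; apply: HH.2 => //; exact: subgroupN. Qed.

Variables (H : vec -> Prop) (u : vec).
Hypothesis HH : subgroup H.
Hypothesis u_free : forall t : int, H (t *: u) -> t = 0.

Definition extend (x : vec) : Prop := exists t : int, H (x - t *: u).

Ltac vec_ring := apply/rowP=> ?; rewrite !mxE; ring.

Lemma extend_subgroup : subgroup extend.
Proof.
split=> [|x y [s Hs] [t Ht]]; first by exists 0; rewrite scale0r subr0; exact: HH.1.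
exists (s - t); rewrite (_ : _ - _ = x - s *: u - (y - t *: u)); last by vec_ring.
exact: HH.2.
Qed.

Variables (F : 'I_k -> vec -> Prop) (dent : 'I_k -> vec -> int) (m : int).
Variable repr : vec -> vec.
Hypothesis reprP : forall x, extend (x - repr x).
Hypothesis repr_eq : forall x y, extend (x - y) -> repr x = repr y.
Hypothesis F_transversal : forall j f f',
  F j f -> F j f' -> extend (f - f') -> f = f'.
Hypothesis dent_inj : forall j f j' f', F j f -> F j' f' ->
  dent j f = dent j' f' -> j = j' /\ f = f'.
Hypothesis dent_bound : forall j f, F j f ->
  2 <= dent j f /\ 4 * dent j f + 16 <= m.

Definition jigsaw_set j (g : vec) : Prop :=
  exists f b, [/\ F j f, piece m (dent j f) b & g = f + b *: u].

(** The new translates are those of the tiling modulo [extend] plus all multiples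
    of [m *: u]. Representatives are chosen first, as two translates that agree
    modulo [extend] would otherwise overlap. *)
Lemma jigsaw_lift : tiles extend F -> tiles H jigsaw_set.
Proof.
case=> A [cov inj].
exists (fun j a => exists a' (s : int), A j a' /\ a = repr a' + (s * m) *: u).
split=> [x|j g a j' g' a' [f [b [Ff pb ->]]] [a1 [s [Aa ->]]]
    [f' [b' [Ff' pb' ->]]] [a1' [s' [Aa' ->]]] Heq].
  have [j [f [a [Ff Aa [t0 Ht0]]]]] := cov x.
  have [t1 Ht1] := reprP a; pose t := t0 + t1.
  have [f2 fm] := dent_bound Ff.
  have [b [s [pb Et]]] : exists b s : int, piece m (dent j f) b /\ t = b + s * m.
    have Et := divz_eq t m.
    have r0 : 0 <= (t %% m)%Z by rewrite modz_ge0; lia.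
    have rm : (t %% m)%Z < m by rewrite ltz_pmod; lia.
    have [Er|Er] := eqVneq (t %% m)%Z (dent j f).
      exists (dent j f + m), ((t %/ m)%Z - 1); split; first by right.
      by rewrite mulrBl -Er {1}Et; lia.
    exists (t %% m)%Z, (t %/ m)%Z; split; last by rewrite {1}Et addrC.
    by left; split; [lia | apply/eqP].
  exists j, (f + b *: u), (repr a + (s * m) *: u); split; first by exists f, b.
    by exists a, s.
  have := subgroupD HH Ht0 Ht1; congr H.
  rewrite (_ : t0 = b + s * m - t1); last by rewrite -Et /t addrK.
  by vec_ring.
have Kaa' : extend (a1 - repr a1) := reprP a1.
have Kaa1' : extend (a1' - repr a1') := reprP a1'.
have [|ej [t Ht]] := inj _ _ _ _ _ _ Ff Aa Ff' Aa'.
  have K : extend (f + repr a1 - (f' + repr a1')).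
    exists (b' + s' * m - b - s * m); move: Heq; congr H; by vec_ring.
  have := extend_subgroup.2 _ _ (subgroupD extend_subgroup K Kaa') Kaa1'.
  by congr extend; vec_ring.
subst j'; have ef : f = f' by apply: (F_transversal Ff Ff'); exists t.
subst f'; have ea : repr a1 = repr a1'.
  apply: repr_eq.
  have K : extend (repr a1 - repr a1').
    exists (b' + s' * m - b - s * m); move: Heq; congr H; by vec_ring.
  have := extend_subgroup.2 _ _ (subgroupD extend_subgroup K Kaa') Kaa1'.
  by congr extend; vec_ring.
split=> //; suff -> : b = b' by rewrite subrr; exact: HH.1.
have {Heq} E : b + s * m - (b' + s' * m) = 0.
  by apply: u_free; move: Heq; rewrite ea; congr H; vec_ring.
have [f2 fm] := dent_bound Ff.
have m0 : 0 < m by lia.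
have [q {}E] : exists q, b - b' = q * m by exists (s' - s); lia.
have Eq : q * m = 0 \/ q * m = m \/ q * m = - m \/ 2 * m <= q * m \/
    q * m <= - (2 * m).
  have [->|[->|[->|[q2|q2]]]] : q = 0 \/ q = 1 \/ q = -1 \/ 2 <= q \/ q <= - 2.
  - by lia.
  - by left; rewrite mul0r.
  - by right; left; rewrite mul1r.
  - by right; right; left; rewrite mulN1r.
  - by do 3!right; left; nia.
  by do 4!right; nia.
by case: pb pb' => [pb|pb] [pb'|pb']; move: pb pb' E Eq; lia.
Qed.

(** The translates are kept. If a point had two representations modulo [extend],
    two different pieces would occur on one line in the direction of [u]. *)
Lemma jigsaw_descend : tiles H jigsaw_set -> tiles extend F.
Proof.
case=> A [cov inj]; exists A; split=> [x|j f a j' f' a' Ff Aa Ff' Aa' [t Ht]].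
  have [j [g [a [[f [b [Ff pb ->]]] Aa Ha]]]] := cov x.
  exists j, f, a; split=> //; exists b; move: Ha; congr H; by vec_ring.
(* The line through [f + a] in the direction of [u]. *)
pose P (p c : int) := exists j f1 a1,
  [/\ F j f1, A j a1, p = dent j f1 & H (f + a + c *: u - (f1 + a1))].
have Pf : P (dent j f) 0.
  by exists j, f, a; split=> //; rewrite scale0r addr0 subrr; exact: HH.1.
have Pf' : P (dent j' f') (- t).
  by exists j', f', a'; split=> //; move: Ht; congr H; vec_ring.
have E : dent j f = dent j' f'.
  apply: (@single_piece m P _ _ _ _ _ _ _ Pf Pf').
  - by move=> _ c [j1 [f1 [a1 [Ff1 _ -> _]]]]; exact: dent_bound.
  - move=> s; have [j1 [g [a1 [[f1 [b [Ff1 pb ->]]] Aa1 Ha]]]] := cov (f + a + s *: u).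
    exists (dent j1 f1), (s - b); rewrite subKr; split=> //.
    by exists j1, f1, a1; split=> //; move: Ha; congr H; vec_ring.
  move=> s _ c _ e [j1 [f1 [a1 [Ff1 Aa1 -> H1]]]] [j2 [f2 [a2 [Ff2 Aa2 -> H2]]]] p1 p2.
  have G1 : jigsaw_set j1 (f1 + (s - c) *: u) by exists f1, (s - c).
  have G2 : jigsaw_set j2 (f2 + (s - e) *: u) by exists f2, (s - e).
  have [|ej Hg] := inj _ _ _ _ _ _ G1 Aa1 G2 Aa2.
    by have := HH.2 _ _ H2 H1; congr H; vec_ring.
  subst j2.
  have Kf : extend (f1 - f2) by exists (c - e); move: Hg; congr H; vec_ring.
  have ef := F_transversal Ff1 Ff2 Kf; subst f2; split=> //.
  apply/eqP; rewrite -subr_eq0 -oppr_eq0; apply/eqP/u_free.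
  by move: Hg; congr H; vec_ring.
have [-> ->] := dent_inj Ff Ff' E; split=> //; rewrite subrr.
exact: extend_subgroup.1.
Qed.

End Tiles.
(** * Reduction of a quotient to a larger group *)

Section TileP.
Variables (d k : nat) (G : zmodType) (rho : 'rV[int]_d -> G).
Local Open Scope ring_scope.
Hypothesis rhoB : {morph rho : x y / x - y}.
Hypothesis rho_surj : forall g, exists v, rho v = g.

Let rho0 : rho 0 = 0. Proof. by rewrite -[X in rho X](subrr 0) rhoB subrr. Qed.
Let rhoD x y : rho (x + y) = rho x + rho y.
Proof. by rewrite -[in LHS](opprK y) -(sub0r y) rhoB rhoB rho0 sub0r opprK. Qed.

(** Translates are pulled back along [rho] in one direction and pushed forward in
    the other. *)
Lemma tile_tiles (Fs : k.-tuple (seq 'rV[int]_d)) :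
  (Tile (fun j => subset_of rho (tnth Fs j)) setT !=set0)%classic <->
  tiles (fun v => rho v = 0) (fun j f => f \in tnth Fs j).
Proof.
have eqG x y : rho (x - y) = 0 <-> rho x = rho y.
  by rewrite rhoB; split=> [/eqP|->]; rewrite ?subrr // subr_eq0 => /eqP.
split=> [[A [S [AS disj cov]]]|[A [cov inj]]].
  exists (fun j a => A j (rho a)); split=> [x|].
    have : (\bigcup_j S j)%classic (rho x) by rewrite cov.
    case=> j _; have [<- _] := AS j.
    case=> _ [f Ff <-] [b Ab Eb]; have [a Ea] := rho_surj b.
    exists j, f, a; split; rewrite ?Ea //.
    by apply/eqG; rewrite rhoD Ea.
  move=> j f a j' f' a' Ff Aa Ff' Aa' /eqG E.
  have Sj i g b : g \in tnth Fs i -> A i (rho b) -> S i (rho (g + b)).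
    move=> Fg Ab; have [<- _] := AS i; rewrite rhoD.
    by exists (rho g); [exists g | exists (rho b)].
  have ej : j = j'.
    apply: disj => //; exists (rho (f + a)); split; first exact: Sj.
    by rewrite E; exact: Sj.
  subst j'; split=> //; apply/eqG.
  have [_ /(_ _ (Sj _ _ _ Ff Aa))[[g b] [_ uniq]]] := AS j.
  have /(congr1 fst) /= E1 : (g, b) = (rho f, rho a).
    by apply: uniq; split=> //; exists f.
  have /(congr1 fst) /= E2 : (g, b) = (rho f', rho a').
    by apply: uniq; split=> //; [exists f' | rewrite E rhoD].
  by rewrite -E1 -E2.
exists (fun j => [set rho a | a in A j]%classic).
exists (fun j => sumset (subset_of rho (tnth Fs j)) [set rho a | a in A j]%classic).
split.
- move=> j; split=> // _ [_ [f Ff <-] [_ [a Aa <-] <-]].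
  exists (rho f, rho a); split; first by split; [exists f | exists a |].
  move=> [_ _] /= [[f' Ff' <-] [a' Aa' <-]]; rewrite -!rhoD => /eqG E.
  have [_ /eqG Ef] := inj _ _ _ _ _ _ Ff Aa Ff' Aa' E.
  by move/eqG: E; rewrite !rhoD Ef => /addrI ->.
- move=> j j' _ _ [_ [[_ [f Ff <-] [_ [a Aa <-] <-]] [_ [f' Ff' <-] [_ [a' Aa' <-]]]]].
  rewrite -!rhoD => /esym/eqG E.
  by have [] := inj _ _ _ _ _ _ Ff Aa Ff' Aa' E.
apply/seteqP; split=> // g _; have [x <-] := rho_surj g.
have [j [f [a [Ff Aa /eqG ->]]]] := cov x.
exists j => //; exists (rho f); first by exists f.
by exists (rho a); [exists a | rewrite rhoD].
Qed.
End TileP.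

Section Step.
Variables (M : turing_machine) (d k : nat).
Local Notation vec := 'rV[int]_d.
Local Notation computable := (computable M).
Local Open Scope ring_scope.
Implicit Types (Fs : seq (seq vec)) (f v : vec).

Definition family Fs (j : 'I_k) (f : vec) : Prop := f \in nth [::] Fs j.

(** ** Numbering vectors *)

Definition digit (a : letter) : nat :=
  match a with Tick => 1 | Minus => 2 | EndInt => 3 | EndVec => 4 | EndSet => 5 end.

(** No digit is zero, so words of different lengths have different numbers. *)
Definition word_number (w : seq letter) : nat :=
  foldr (fun a n => 6 * n + digit a)%N 0%N w.

Lemma word_number_inj : injective word_number.
Proof.
elim=> [|a v IH] [|b w] //=; [by case: b => /=; lia | by case: a => /=; lia | move=> E].
have /IH Evw : word_number v = word_number w by case: a b E => -[] /=; lia.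
by rewrite Evw in E *; case: a b E => -[] //=; lia.
Qed.

(** The number [j] is below [k], which makes it a digit in base [k]; adding 2 keeps
    the dent away from the left end of the piece. *)
Definition dent_position (j : nat) (f : vec) : nat :=
  (k * word_number (enc_vec f) + j + 2)%N.

Lemma dent_position_inj j j' f f' : (j < k)%N -> (j' < k)%N ->
  dent_position j f = dent_position j' f' -> j = j' /\ f = f'.
Proof.
move=> jk jk' /eqP; rewrite !eqn_add2r !(mulnC k) => /eqP E.
have : ((word_number (enc_vec f) * k + j) %/ k =
  (word_number (enc_vec f') * k + j') %/ k)%N by rewrite E.
rewrite !divnMDl ?(leq_ltn_trans _ jk) // !divn_small // !addn0 => En.
split; last exact: enc_vec_inj (word_number_inj En).
by move: E; rewrite En => /addnI.
Qed.

(** Large enough for every dent to lie in the left quarter of its piece. *)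
Definition period Fs : nat :=
  (4 * sumn [seq dent_position k f | f <- flatten Fs] + 16)%N.

Lemma dent_period Fs j f s : (j < k)%N -> s \in Fs -> f \in s ->
  (4 * dent_position j f + 16 <= period Fs)%N.
Proof.
move=> jk sFs fs; rewrite leq_add2r leq_mul2l /=.
apply: (@leq_trans (dent_position k f)); first by rewrite /dent_position; lia.
have : f \in flatten Fs by apply/flattenP; exists s.
elim: (flatten Fs) => //= g r IH; rewrite in_cons => /orP[/eqP<-|/IH]; lia.
Qed.

(** ** The lists of jigsaw pieces *)

Variable u : vec.

Definition ray f (n : nat) : vec * seq vec :=
  iter n (fun p => (p.1 + u, p.1 :: p.2)) (f, [::]).

Lemma ray_end f n : (ray f n).1 = f + n%:Z *: u.
Proof.
elim: n => [|n IH] /=; first by rewrite scale0r addr0.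
by rewrite -/(ray f n) IH -addrA -{2}[u]scale1r -scalerDl -PoszD addn1.
Qed.

Lemma mem_ray f n g :
  g \in (ray f n).2 <-> exists2 t : nat, (t < n)%N & g = f + t%:Z *: u.
Proof.
elim: n g => [|n IH] g /=; first by split=> // -[].
rewrite -/(ray f n) in_cons ray_end; split=> [/orP[/eqP->|/IH[t tn ->]]|[t]].
- by exists n.
- by exists t => //; exact: ltnW.
rewrite ltnS leq_eqVlt => /orP[/eqP->->|tn ->]; first by rewrite eqxx.
by apply/orP; right; apply/IH; exists t.
Qed.

Definition piece_list (m a : nat) f : seq vec :=
  let before := ray f a in
  let after := ray (before.1 + u) (m - a.+1) in
  (ray after.1 a).1 :: after.2 ++ before.2.

Lemma mem_piece_list m a f g : (a < m)%N ->
  g \in piece_list m a f <-> exists b, piece m a b /\ g = f + b *: u.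
Proof.
move=> am; have shift (s t : int) : f + s *: u + t *: u = f + (s + t) *: u.
  by rewrite scalerDl addrA.
have Ea : f + a%:Z *: u + u = f + (a%:Z + 1) *: u by rewrite -{2}[u]scale1r shift.
rewrite in_cons mem_cat /piece_list /= !ray_end Ea !shift.
split=> [/or3P[/eqP->|/mem_ray[t lt_t ->]|/mem_ray[t lt_t ->]]|[b [[[b0 ba]|->] ->]]].
- by exists (a%:Z + m%:Z); split; [right; lia | congr (_ + _ *: _); lia].
- by exists (a%:Z + 1 + t%:Z); split; [left; split; lia | rewrite shift].
- by exists t%:Z; split=> //; left; split; lia.
- case: b b0 ba => // b b0 ba; apply/or3P.
  have [lt_ba|le_ab] := ltnP b a; first by apply: Or33; apply/mem_ray; exists b.
  apply: Or32; apply/mem_ray; exists (b - a.+1)%N; first by lia.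
  by rewrite shift; congr (_ + _ *: _); lia.
by apply/or3P/Or31/eqP; congr (_ + _ *: _); lia.
Qed.

(** The number [size out] of the lists that follow identifies the list [s]. *)
Definition jigsaw Fs : seq (seq vec) :=
  foldr (fun s out => flatten [seq
    piece_list (period Fs) (dent_position (size out) f) f | f <- s] :: out) [::] Fs.

Lemma foldr_positions A B (g : nat -> A -> B) a b (s : seq A) j :
  let t := foldr (fun x out => g (size out) x :: out) [::] s in
  size t = size s /\
  ((j < size s)%N -> nth b t j = g (size s - j.+1)%N (nth a s j)).
Proof.
elim: s j => [|x s IH] j //=; have [Es _] := IH 0%N; rewrite Es; split=> //.
by case: j => [|j]; [rewrite subn1 | rewrite ltnS => /(proj2 (IH j))].
Qed.

Lemma size_jigsaw Fs : size (jigsaw Fs) = size Fs.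
Proof.
by have [] := foldr_positions (fun n s => flatten [seq
  piece_list (period Fs) (dent_position n f) f | f <- s]) [::] [::] Fs 0.
Qed.

Lemma family_jigsaw Fs j g : size Fs = k ->
  family (jigsaw Fs) j g <->
  jigsaw_set u (family Fs) (fun j f => dent_position (k - j.+1) f) (period Fs) j g.
Proof.
move=> sz; have [_] := foldr_positions (fun n s => flatten [seq
  piece_list (period Fs) (dent_position n f) f | f <- s]) [::] [::] Fs j.
rewrite -/(jigsaw _) sz => /(_ (ltn_ord j)) E; rewrite /family E.
have lt_period f : f \in nth [::] Fs j -> (dent_position (k - j.+1) f < period Fs)%N.
  have jk := ltn_ord j.
  move=> Ff; have := @dent_period Fs (k - j.+1) f (nth [::] Fs j).
  by rewrite mem_nth ?sz // => /(_ _ isT Ff); lia.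
split=> [/flattenP[_ /mapP[f Ff ->]]|[f [b [Ff pb ->]]]].
  by case/mem_piece_list=> [|b [pb ->]]; [exact: lt_period | exists f, b].
apply/flattenP; exists (piece_list (period Fs) (dent_position (k - j.+1) f) f).
  by apply/mapP; exists f.
by apply/mem_piece_list; [exact: lt_period | exists b].
Qed.

(** ** Representatives *)

Variables (i : 'I_d) (n : nat).

Definition reduce_step v : vec :=
  match v ord0 i with
  | Posz q => if (n <= q)%N then v - u else v
  | Negz _ => v + u
  end.

(** Every step that changes [v] brings the coordinate closer to 0 or into range, so
    its absolute value bounds the number of steps. *)
Definition reduce v : vec := iter `|v ord0 i|%N reduce_step v.

Lemma reduce_shift v : exists t : int, reduce v = v + t *: u.
Proof.
rewrite /reduce; elim: `|_|%N => [|m [t IH]] /=.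
  by exists 0; rewrite scale0r addr0.
rewrite IH /reduce_step; case: (_ ord0 i) => q; last first.
  by exists (t + 1); rewrite scalerDl scale1r addrA.
by case: ifP => _; [exists (t - 1); rewrite scalerBl scale1r addrA | exists t].
Qed.

Lemma reduce_bound v : u ord0 i = n -> (0 < n)%N ->
  0 <= reduce v ord0 i < n%:Z.
Proof.
move=> ui n0.
have red m v' : (`|v' ord0 i| <= m)%N \/ 0 <= v' ord0 i < n%:Z ->
    0 <= iter m reduce_step v' ord0 i < n%:Z.
  elim: m v' => [|m IH] w hw; first by rewrite /=; lia.
  rewrite iterSr; apply: IH; rewrite /reduce_step.
  case E: (w ord0 i) hw => [q|q] hw; last by rewrite mxE E ui; lia.
  by case: ifP => nq; rewrite ?mxE ?mxE ?E ?ui; lia.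
by apply: red; left.
Qed.

Lemma reduce_comp : computable reduce.
Proof.
have step_comp : computable reduce_step.
  apply: (comp_case_int (f := fun v q => if (n <= q)%N then v - u else v)
    (g := fun v _ => v + u)); first exact: comp_coord.
    apply: comp_if.
        by apply: comp_leq; [exact: comp_const | exact: comp_snd (comp_id _ _)].
      exact: comp_comp (comp_translate _ (- u)) (comp_fst (comp_id _ _)).
    exact: comp_fst (comp_id _ _).
  exact: comp_comp (comp_translate _ u) (comp_fst (comp_id _ _)).
apply: (comp_iter (f := fun _ v => reduce_step v)).
- exact: comp_comp (comp_absz M) (comp_coord _ i).
- exact: comp_id.
exact: comp_comp step_comp (comp_snd (comp_id _ _)).
Qed.

(** ** Computability of the pieces *)

Lemma word_number_comp : computable word_number.
Proof.
apply: (comp_foldr (f := fun _ a n => (6 * n + digit a)%N) (z := fun=> 0%N)).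
- exact: comp_id.
- exact: comp_const.
apply: comp_add.
  apply: comp_mul; first exact: comp_const.
  exact: comp_snd (comp_snd (comp_id _ _)).
apply: (comp_letter (f := fun a _ => digit a)).
  exact: comp_fst (comp_snd (comp_id _ _)).
by move=> a; exact: comp_const.
Qed.

Lemma dent_position_comp X (encX : encodable X) (j : X -> nat) (f : X -> vec) :
  computable j -> computable f -> computable (fun x => dent_position (j x) (f x)).
Proof.
move=> cj cf; apply: comp_add (comp_const _ _ _ _).
apply: comp_add cj; apply: comp_mul; first exact: comp_const.
exact: comp_comp word_number_comp (comp_comp (enc_vec_comp M d) cf).
Qed.

Lemma period_comp : computable period.
Proof.
apply: comp_add (comp_const _ _ _ _); apply: comp_mul; first exact: comp_const.
apply: comp_sumn; apply: (comp_map (f := fun=> dent_position k)).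
  by apply: dent_position_comp; [exact: comp_const | exact: comp_snd (comp_id _ _)].
by apply: comp_flatten; exact: comp_id.
Qed.

Lemma ray_comp X (encX : encodable X) (f : X -> vec) (m : X -> nat) :
  computable f -> computable m -> computable (fun x => ray (f x) (m x)).
Proof.
move=> cf cm; apply: (comp_iter (f := fun _ p => (p.1 + u, p.1 :: p.2)) cm).
  by apply: comp_pair cf _; exact: comp_const.
have cp : computable (fun p : X * (vec * seq vec) => p.2).
  exact: comp_snd (comp_id _ _).
apply: comp_pair; first exact: comp_comp (comp_translate _ u) (comp_fst cp).
by apply: comp_cons; [exact: comp_fst | exact: comp_snd].
Qed.

Lemma piece_list_comp X (encX : encodable X) (m a : X -> nat) (f : X -> vec) :
  computable m -> computable a -> computable f ->
  computable (fun x => piece_list (m x) (a x) (f x)).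
Proof.
move=> cm ca cf; rewrite /piece_list /=.
have cb : computable (fun x => ray (f x) (a x)) by exact: ray_comp.
have cc : computable (fun x => ray ((ray (f x) (a x)).1 + u) (m x - (a x).+1)).
  apply: ray_comp; first exact: comp_comp (comp_translate _ u) (comp_fst cb).
  by apply: comp_sub cm _; exact: comp_succ.
apply: comp_cons; last by apply: comp_cat; exact: comp_snd.
by apply: comp_fst; apply: ray_comp ca; exact: comp_fst.
Qed.

Lemma jigsaw_comp : computable jigsaw.
Proof.
apply: (comp_foldr (s := fun Fs => Fs) (z := fun=> [::]) (f := fun Fs s out =>
  flatten [seq piece_list (period Fs) (dent_position (size out) f) f | f <- s]
    :: out)); [exact: comp_id | exact: comp_const |].
have cp : computable (fun p : seq (seq vec) * (seq vec * seq (seq vec)) => p)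
  by exact: comp_id.
apply: comp_cons; last exact: comp_snd (comp_snd cp).
apply: comp_flatten; apply: (comp_map (f := fun p f =>
  piece_list (period p.1) (dent_position (size p.2.2) f) f)); last first.
  exact: comp_fst (comp_snd cp).
have cq : computable (fun q : seq (seq vec) * (seq vec * seq (seq vec)) * vec => q)
  by exact: comp_id.
apply: piece_list_comp; last exact: comp_snd.
  exact: comp_comp period_comp (comp_fst (comp_fst cq)).
apply: dent_position_comp; last exact: comp_snd.
by apply: comp_size; exact: comp_snd (comp_snd (comp_fst cq)).
Qed.

(** ** One step *)

Lemma tiles_representatives (H : vec -> Prop) (F F' : 'I_k -> vec -> Prop) :
  subgroup H ->
  (forall j f, F j f -> exists2 f', F' j f' & H (f - f')) ->
  (forall j f', F' j f' -> exists2 f, F j f & H (f - f')) ->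
  tiles H F -> tiles H F'.
Proof.
move=> HH FF' F'F [A [cov inj]]; exists A.
split=> [x|j f a j' f' a' Ff Aa Ff' Aa' E].
  have [j [f [a [Ff Aa Hx]]]] := cov x; have [f' Ff' Hf] := FF' j f Ff.
  exists j, f', a; split=> //; have := subgroupD HH Hx Hf; congr H.
  by apply/rowP=> ?; rewrite !mxE; ring.
have [g Fg Hg] := F'F _ _ Ff; have [g' Fg' Hg'] := F'F _ _ Ff'.
have [|ej Hgg] := inj _ _ _ _ _ _ Fg Aa Fg' Aa'.
  have := HH.2 _ _ (subgroupD HH E Hg) Hg'; congr H.
  by apply/rowP=> ?; rewrite !mxE; ring.
split=> //; have := subgroupD HH (HH.2 _ _ Hgg Hg) Hg'; congr H.
by apply/rowP=> ?; rewrite !mxE; ring.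
Qed.

End Step.

(** * All quotients *)

Section Reduction.
Variables (M : turing_machine) (d k : nat).
Local Notation vec := 'rV[int]_d.
Local Notation computable := (computable M).
Local Notation fam := (@family d k).
Local Open Scope ring_scope.
Implicit Types (H : vec -> Prop).

(** The canonical representatives [c] are part of the induction hypothesis, since
    those for a larger subgroup are computed from them. *)
Definition reducible H : Prop :=
  exists (c : vec -> vec) (g : seq (seq vec) -> seq (seq vec)),
  [/\ computable c, forall v, H (v - c v), forall v w, H (v - w) -> c v = c w,
      computable g &
      forall Fs, size Fs = k -> size (g Fs) = k /\
        (tiles H (fam Fs) <-> tiles (fun v => v = 0) (fam (g Fs)))].

Lemma reducible0 : reducible (fun v => v = 0).
Proof.
exists id, id; split=> //; [exact: comp_id | by move=> v; rewrite subrr | |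
  exact: comp_id].
by move=> v w /eqP; rewrite subr_eq0 => /eqP.
Qed.

(** Reducing the coordinate [i] modulo [n] determines the multiple of [u] to be
    subtracted, so that vectors congruent modulo [extend H u] become congruent
    modulo [H]. *)
Lemma reducible_extend H (u : vec) (i : 'I_d) (n : nat) :
  subgroup H -> (forall v, H v -> v ord0 i = 0) -> u ord0 i = n -> (0 < n)%N ->
  reducible H -> reducible (extend H u).
Proof.
move=> HH Hi ui n0 [c [g [cc Hc c_eq cg gP]]].
have u_free t : H (t *: u) -> t = 0.
  by move=> /Hi; rewrite mxE ui => /eqP; rewrite mulf_eq0 => /orP[/eqP//|/eqP]; lia.
have KK := extend_subgroup u HH.
pose r v := c (reduce u i n v).
have rP v : extend H u (v - r v).
  have [t Et] := reduce_shift u i n v; exists (- t).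
  have := Hc (reduce u i n v); rewrite -/(r v) {1}Et; congr H.
  by apply/rowP=> ?; rewrite !mxE; ring.
have r_eq v w : extend H u (v - w) -> r v = r w.
  case=> t Ht; apply: c_eq.
  have [a Ea] := reduce_shift u i n v; have [b Eb] := reduce_shift u i n w.
  have := reduce_bound v ui n0; have := reduce_bound w ui n0.
  have := Hi _ Ht; rewrite Ea Eb !mxE ui => E1 bw bv.
  have Et : t + a - b = 0.
    move: E1 bw bv; move: (v ord0 i) (w ord0 i) => x y E1 bw bv.
    have : (t + a - b) * n%:Z = x + a * n%:Z - (y + b * n%:Z).
      by rewrite -[LHS]addr0 -E1; ring.
    move: (t + a - b) => q Eq; have [//|[q1|q1]] : q = 0 \/ 1 <= q \/ q <= -1 by lia.
      have : n%:Z <= q * n%:Z by rewrite ler_peMl //; lia.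
      lia.
    have : n%:Z <= (- q) * n%:Z by rewrite ler_peMl //; lia.
    rewrite mulNr; lia.
  move: Ht; congr H; rewrite (_ : t = b - a); last by lia.
  by apply/rowP=> ?; rewrite !mxE; ring.
pose reps := map (map r).
exists r, (fun Fs => g (jigsaw k u (reps Fs))); split=> //.
- exact: comp_comp cc (reduce_comp _ _ _ _).
- apply: (comp_comp cg); apply: (comp_comp (jigsaw_comp M k u)).
  apply: (comp_map (f := fun=> map r)); last exact: comp_id.
  apply: (comp_map (f := fun=> r)); last exact: comp_snd (comp_id _ _).
  exact: comp_comp (comp_comp cc (reduce_comp _ _ _ _)) (comp_snd (comp_id _ _)).
move=> Fs sz; have szr : size (reps Fs) = k by rewrite size_map.
have szj : size (jigsaw k u (reps Fs)) = k by rewrite size_jigsaw.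
have [szg tilesP] := gP _ szj; split=> //.
have nth_reps (j : 'I_k) : nth [::] (reps Fs) j = map r (nth [::] Fs j).
  by rewrite (nth_map [::]) ?sz.
have famr j f : fam (reps Fs) j f -> exists2 f0, fam Fs j f0 & f = r f0.
  by rewrite /family nth_reps => /mapP.
have famI j f : fam Fs j f -> fam (reps Fs) j (r f).
  by move=> Ff; rewrite /family nth_reps map_f.
pose dent (j : 'I_k) (f : vec) : int := dent_position k (k - j.+1) f.
pose m : int := period k (reps Fs).
have pos_lt (j : 'I_k) : (k - j.+1 < k)%N by have := ltn_ord j; lia.
have transversal (j : 'I_k) f f' : fam (reps Fs) j f -> fam (reps Fs) j f' ->
    extend H u (f - f') -> f = f'.
  move=> /famr[f0 _ ->] /famr[f0' _ ->] K; apply: r_eq.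
  have := subgroupD KK (KK.2 _ _ K (KK.2 _ _ KK.1 (rP f0)))
    (KK.2 _ _ KK.1 (rP f0')).
  by congr extend; apply/rowP=> ?; rewrite !mxE; ring.
have dent_inj (j : 'I_k) f (j' : 'I_k) f' : fam (reps Fs) j f ->
    fam (reps Fs) j' f' -> dent j f = dent j' f' -> j = j' /\ f = f'.
  move=> _ _ [/(dent_position_inj (pos_lt j) (pos_lt j'))[E ->]]; split=> //.
  by apply: val_inj => /=; have := ltn_ord j; have := ltn_ord j'; lia.
have dent_bound (j : 'I_k) f : fam (reps Fs) j f ->
    2 <= dent j f /\ 4 * dent j f + 16 <= m.
  move=> Ff; have := @dent_period _ k (reps Fs) (k - j.+1) f
    (nth [::] (reps Fs) j) (pos_lt j).
  rewrite mem_nth ?szr // => /(_ isT Ff); rewrite /dent /m.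
  by have : (2 <= dent_position k (k - j.+1) f)%N by rewrite leq_addl; lia.
have -> : tiles (extend H u) (fam Fs) <-> tiles (extend H u) (fam (reps Fs)).
  split; apply: tiles_representatives => // j f.
  - by move=> Ff; exists (r f); [exact: famI | exact: rP].
  - by case/famr=> f0 Ff0 ->; exists f0; [| exact: rP].
  - case/famr=> f0 Ff0 ->; exists f0 => //.
    by have := KK.2 _ _ KK.1 (rP f0); rewrite sub0r opprB.
  by move=> Ff; exists (r f); [exact: famI | rewrite -opprB; exact: subgroupN KK (rP f)].
rewrite -tilesP (_ : fam (jigsaw k u (reps Fs)) =
  jigsaw_set u (fam (reps Fs)) dent m).
  split; first exact: (jigsaw_lift HH u_free rP r_eq transversal dent_bound).
  exact: (jigsaw_descend HH u_free transversal dent_inj dent_bound).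
apply: funext => j; apply: funext => f; apply: propext.
exact: family_jigsaw.
Qed.

(** The subgroups cut out of a kernel by the vanishing of more and more
    coordinates; two consecutive ones differ by at most one generator. *)
Definition truncate H (l : nat) (v : vec) : Prop :=
  H v /\ forall i : 'I_d, (i < l)%N -> v ord0 i = 0.

Lemma truncate_subgroup H l : subgroup H -> subgroup (truncate H l).
Proof.
move=> HH; split=> [|x y [Hx x0] [Hy y0]].
  by split=> [|i _]; [exact: HH.1 | rewrite mxE].
by split=> [|i il]; [exact: HH.2 | rewrite !mxE x0 // y0].
Qed.

Lemma subgroupZ H (t : int) v : subgroup H -> H v -> H (t *: v).
Proof.
move=> HH Hv; have Hn (n : nat) : H (n%:Z *: v).
  elim: n => [|n IH]; first by rewrite scale0r; exact: HH.1.
  by rewrite intS scalerDl scale1r; exact: subgroupD.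
by case: t => n; rewrite ?NegzE ?scaleNr //; apply: subgroupN.
Qed.

(** The generator has the smallest positive coordinate that occurs: all others are
    multiples of it by division with remainder. *)
Lemma truncate_step H (i : 'I_d) : subgroup H ->
  truncate H i = truncate H i.+1 \/
  exists (u : vec) (n : nat), [/\ u ord0 i = n, (0 < n)%N &
    truncate H i = extend (truncate H i.+1) u].
Proof.
move=> HH; have HT := truncate_subgroup i HH.
have next v : truncate H i v -> v ord0 i = 0 -> truncate H i.+1 v.
  move=> [Hv v0] vi; split=> // j; rewrite ltnS leq_eqVlt => /orP[/eqP/val_inj->//|].
  exact: v0.
have prev v : truncate H i.+1 v -> truncate H i v.
  by case=> Hv v0; split=> // j ji; apply: v0; exact: ltnW.
pose Q (n : nat) := `[< (0 < n)%N /\ exists2 v, truncate H i v & v ord0 i = n >].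
have [exQ|noQ] := pselect (exists n, Q n); last first.
  left; apply: funext => v; apply: propext; split=> [Tv|]; last exact: prev.
  apply: next => //; apply: contrapT => vi; apply: noQ.
  exists `|v ord0 i|%N; apply/asboolP; split; first by rewrite absz_gt0; apply/eqP.
  have [v0|v0] := lerP 0 (v ord0 i); first by exists v; rewrite ?gez0_abs.
  by exists (- v); [exact: subgroupN | rewrite mxE ltz0_abs].
right; have [n /asboolP[n0 [u Tu ui]] n_min] := ex_minnP exQ.
exists u, n; split=> //; apply: funext => v; apply: propext; split=> [Tv|[t Tt]].
  exists (v ord0 i %/ n)%Z.
  have Tw : truncate H i (v - (v ord0 i %/ n)%Z *: u).
    by apply: HT.2 => //; exact: subgroupZ.
  apply: next => //; apply: contrapT => wi.
  have Ew : (v - (v ord0 i %/ n)%Z *: u) ord0 i = (v ord0 i %% n)%Z.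
    by rewrite !mxE ui {1}(divz_eq (v ord0 i) n) addrC addKr.
  have r0 : 0 <= (v ord0 i %% n)%Z by rewrite modz_ge0; lia.
  have rn : (v ord0 i %% n)%Z < n by rewrite ltz_pmod.
  have : Q `|(v ord0 i %% n)%Z|%N.
    apply/asboolP; split; first by rewrite Ew in wi; lia.
    by exists (v - (v ord0 i %/ n)%Z *: u); rewrite ?Ew //; lia.
  by move=> /n_min; lia.
rewrite -(subrK (t *: u) v); apply: subgroupD => //; first exact: prev.
exact: subgroupZ.
Qed.

Lemma reducible_subgroup H : subgroup H -> reducible H.
Proof.
move=> HH; suff red n : (n <= d)%N -> reducible (truncate H (d - n)).
  rewrite (_ : H = truncate H (d - d)); first exact: red.
  by rewrite subnn; apply: funext => v; apply: propext; split=> [|[]].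
elim: n => [|n IH] nd.
  rewrite subn0 (_ : truncate H d = fun v => v = 0); first exact: reducible0.
  apply: funext => v; apply: propext; split=> [[_ v0]|->].
    by apply/rowP=> i; rewrite v0 // mxE.
  by split=> [|i _]; [exact: HH.1 | rewrite mxE].
have lt_d : (d - n.+1 < d)%N by lia.
have /= Ei : (Ordinal lt_d).+1 = (d - n)%N by rewrite /= -subSn // subSS.
have {}IH := IH (ltnW nd); rewrite -Ei in IH.
rewrite -[(d - n.+1)%N]/(nat_of_ord (Ordinal lt_d)).
have [->//|[u [m [ui m0 ->]]]] := truncate_step (Ordinal lt_d) HH.
apply: reducible_extend ui m0 IH; first exact: truncate_subgroup.
by move=> v [_]; apply; exact: ltnSn.
Qed.

End Reduction.

Local Open Scope ring_scope.

Theorem corollary1p3 (d : nat) (hd : (0 < d)%N) (G : zmodType)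
  (pi : {additive 'rV[int]_d -> G}) (pi_surj : forall g : G, exists v, pi v = g)
  (k : nat) (hk : (0 < k)%N) :
  tiling_decidable (fun v : 'rV[int]_d => v) k -> tiling_decidable pi k.
Proof.
case=> M decM.
have kerP : subgroup (fun v => pi v = 0).
  by split=> [|x y px py]; rewrite ?raddf0 // raddfB px py subrr.
have [c [g [_ _ _ cg gP]]] := @reducible_subgroup M d k _ kerP.
have [N redN] := computable_reduction
  (comp_comp (print_lists_comp M d) (comp_comp cg (parse_lists_comp M d))).
exists N => Fs; have [haltsN accN] := redN (enc_lists Fs).
have [sz tilesP] := gP Fs (size_tuple Fs).
have E : enc_lists (Tuple (introT eqP sz)) =
    print_lists (g (parse_lists d (enc_lists Fs))).
  by rewrite -[enc_lists Fs]/(print_lists Fs) print_listsK.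
rewrite -E in haltsN accN; have [haltsM accM] := decM (Tuple (introT eqP sz)).
split; first exact: haltsN.
have idE := @tile_tiles d k _ (fun v => v) (fun _ _ => erefl)
  (fun v => ex_intro _ v erefl) (Tuple (introT eqP sz)).
have piE := @tile_tiles d k G pi (raddfB pi) pi_surj Fs.
have famE (t : k.-tuple (seq 'rV[int]_d)) :
    (fun j f => is_true (f \in tnth t j)) = @family d k t.
  by apply: funext => j; apply: funext => f; rewrite /family (tnth_nth [::]).
rewrite !famE in idE piE; rewrite accN accM.
exact: iff_trans idE (iff_sym (iff_trans piE tilesP)).
Qed.
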